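(* For a (multi-)knotoid $K$ in $S^2$, $W_K(t=-1,q,u)=T_K(q,u)$, where $W_K$ is the Poincaré polynomial of the winding homology of $K$ and $T_K$ is the Turaev polynomial of $K$.
   Context: **Knotoids.** A knotoid diagram in $S^2$ is a generic immersion $K:[0,1]\to S^2$ whose only multiple points are transversal double points (crossings), each with over/under information; the images of $0$ and $1$ are the leg and the head, and $K$ is oriented from leg to head. A multi-knotoid diagram is defined the same way but may have additional (oriented) closed components, with still exactly one segment component. A (multi-)knotoid is an equivalence class of diagrams under ambient isotopy of $S^2$ preserving orientations and Reidemeister moves performed away from the leg and head. Let $n$ be the number of crossings of $K$, $n_\pm$ the number of positive/negative crossings. A shortcut is a generic immersed arc $\alpha$ in $S^2$ oriented from the leg to the head of $K$. **States.** The 0-smoothing of a crossing merges the two regions swept when the overstrand is rotated counterclockwise onto the understrand; the 1-smoothing merges the other two regions. A state is a function $s$ from the set of crossings to $\{0,1\}$, identified with the corresponding complete smoothing of $K$; $S(K)$ is the set of states. A state consists of one segment component $k_s$, oriented from leg to head, and some closed components; $|s|$ is the total number of components and $\|s\|=|s^{-1}(1)|$. Smoothings are done away from $\alpha\cap K$. $k_s\cdot\alpha$ (resp. $K\cdot\alpha$) is the number of times $k_s$ (resp. $K$, all components counted) crosses $\alpha$ from right to left minus the number of times from left to right, endpoints excluded. Put $\mu(s)=k_s\cdot\alpha-K\cdot\alpha$. **Turaev polynomial.** $T_K(A,u)=(-A^3)^{-(n_+-n_-)}u^{-K\cdot\alpha}\sum_{s\in S(K)}A^{n-2\|s\|}u^{k_s\cdot\alpha}(-A^2-A^{-2})^{|s|-1}$;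 in the variable $q=-A^{-2}$ it reads $$T_K(q,u)=(-1)^{n_-}q^{n_+-2n_-}\sum_{s\in S(K)}u^{\mu(s)}(-q)^{\|s\|}(q+q^{-1})^{|s|-1}.$$ **Winding homology.** Order the crossings $c_1<\dots<c_n$. Let $\mathcal{V}_s$ be the $\mathbb{Q}$-vector space with ordered basis $s^{-1}(1)$. Let $\mathcal{A}=\mathbb{Q}[X]/(X^2)$, graded by $\deg 1=1$, $\deg X=-1$, additively on tensor products. Put $$C_i(K)=\bigoplus_{s\in S(K),\ \|s\|=i+n_-}\mathcal{A}^{\otimes(|s|-1)}\otimes X\mathcal{A}\otimes\bigwedge\nolimits^{\|s\|}\mathcal{V}_s,$$ where each closed component carries a copy of $\mathcal{A}$ and the segment component carries $X\mathcal{A}=\mathbb{Q}X$. A generator $v$ in the summand of $s$ has homological grading $i(v)=\|s\|-n_-$, $q$-grading $q(v)=\deg(v)+i(v)+n_+-n_-+1$, and $u$-grading $\mu(v)=\mu(s)$. If $s,s'$ differ at exactly one crossing $c_0$, with $s(c_0)=0$, $s'(c_0)=1$, the edge map sends $v\otimes w\otimes x$ to $f(v)\otimes w\otimes(c_0\wedge x)$, where $v$ lies in the factors of the components changed at $c_0$, $w$ in the others, and $f$ is: multiplication $\mathcal{A}\otimes\mathcal{A}\to\mathcal{A}$ when two closed components merge; multiplication $\mathcal{A}\otimes X\mathcal{A}\to X\mathcal{A}$ when a closed component merges into the segment; $1\mapsto 1\otimes X+X\otimes 1$, $X\mapsto X\otimes X$ when a closed component divides; $X\mapsto X\otimes X\in\mathcal{A}\otimes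 X\mathcal{A}$ when a closed component splits off the segment; $0$ when the segment component changes into a segment component with the number of components unchanged. The differential $d$ is the sum of all edge maps. $H_{i,j}^k(K)$ is the homology of $(C(K),d)$ in homological grading $i$, $q$-grading $j$, $u$-grading $k$, and $W_K(t,q,u)=\sum_{i,j,k}t^iq^ju^k\dim_{\mathbb{Q}}H_{i,j}^k(K)$. *)

(* Defs.v *)
From HB Require Import structures.
From mathcomp Require Import all_boot all_order all_algebra.
From mathcomp Require Import zify ring.

Set Implicit Arguments.
Unset Strict Implicit.
Unset Printing Implicit Defensive.

Import Order.TTheory GRing.Theory Num.Theory.
Local Open Scope ring_scope.

(* Multi-knotoid diagrams in the sphere are encoded by oriented planar diagram
   codes.  A diagram has n crossings, the leg, the head, and m further marked
   points in the interior of its strands; marked points change nothing, but a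
   closed component without crossings must carry one in order to be visible.
   Cutting the diagram at all these points gives edges, and a dart is an end of
   an edge:
   - four darts (c, 0), (c, 1), (c, 2), (c, 3) at the crossing c, listed
     counterclockwise, (c, 0) being the end of the incoming understrand, so
     that the understrand is 0 -> 2 and the overstrand joins 1 and 3;
   - two darts at each marked point;
   - one dart at the leg and one at the head.                                 *)
Definition dart (n m : nat) : finType :=
  ('I_n * 'I_4 + 'I_m * bool + bool)%type.

Section Darts.
Variables n m : nat.

Definition xdart (c : 'I_n) (k : 'I_4) : dart n m := inl (inl (c, k)).
Definition mdart (i : 'I_m) (b : bool) : dart n m := inl (inr (i, b)).
Definition ldart : dart n m := inr false.
Definition hdart : dart n m := inr true.

Definition under_in (c : 'I_n) := xdart c (@Ordinal 4 0 isT).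
Definition under_out (c : 'I_n) := xdart c (@Ordinal 4 2 isT).
Definition over_right (c : 'I_n) := xdart c (@Ordinal 4 1 isT).
Definition over_left (c : 'I_n) := xdart c (@Ordinal 4 3 isT).

(* The next dart, clockwise, around the same point. *)
Definition clockwise (d : dart n m) : dart n m :=
  match d with
  | inl (inl (c, k)) => xdart c (ord_pred k)
  | inl (inr (i, b)) => mdart i (~~ b)
  | inr e => inr e
  end.

End Darts.

Arguments ldart {n m}.
Arguments hdart {n m}.
Arguments under_in {n m} c.
Arguments under_out {n m} c.
Arguments over_right {n m} c.
Arguments over_left {n m} c.

(* [edge d] is the other end of the edge of d; [out d] holds when the oriented
   diagram leaves its crossing, marked point or leg along d; [region d] is the
   region of the complement of the diagram lying to the left of the edge of d
   when it is followed from d to [edge d].                                    *)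
Record pdcode (n m : nat) := PDCode {
  edge : dart n m -> dart n m;
  out : pred (dart n m);
  nregions : nat;
  region : dart n m -> 'I_nregions }.

Section Diagram.
Variables (n m : nat) (K : pdcode n m).
Local Notation D := (dart n m).

(* Follow an edge, then turn left: the orbits are the boundary walks of the
   faces, with the face on the left.                                          *)
Definition face (d : D) : D := clockwise (edge K d).

Definition piece_rel : rel D :=
  [rel x y | [|| y == edge K x, y == clockwise x | x == clockwise y]].

(* The number of connected components of the diagram as a subset of the sphere. *)
Definition npieces : nat := n_comp piece_rel D.

Record oriented : Prop := Oriented {
  edgeK : involutive (edge K);
  edge_neq : forall d, edge K d != d;
  out_edge : forall d, out K (edge K d) = ~~ out K d;
  out_leg : out K ldart;
  out_head : ~~ out K hdart;
  out_marked : forall i, out K (mdart n i true) = ~~ out K (mdart n i false);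
  out_under_in : forall c, ~~ out K (under_in c);
  out_under_out : forall c, out K (under_out c);
  out_over : forall c, out K (over_right c) = ~~ out K (over_left c) }.

(* Each connected component of the diagram is planar by Euler's formula
   V - E + F = 2.  Since the diagram may be disconnected, a region of the
   sphere may be bounded by several faces of distinct components; gluing the
   components along the regions yields a sphere exactly when the bipartite
   graph with vertices the components and the regions, and with edges the
   faces, is a tree: it is connected and #faces + 1 = #components + #regions. *)
Record spherical : Prop := Spherical {
  planar_pieces :
    (fcard (@clockwise n m) D + fcard face D = fcard (edge K) D + npieces.*2)%N;
  region_face : forall d, region K (face d) = region K d;
  region_onto : forall r, exists d, region K d = r;
  region_connected : forall x y : D,
    connect [rel x y | piece_rel x y || (region K x == region K y)] x y;
  region_tree : (fcard face D + 1 = npieces + nregions K)%N }.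

Definition multiknotoid_diagram : Prop := oriented /\ spherical.

(* The directions of the overstrand and of the understrand form a positively
   oriented frame when the overstrand runs 3 -> 1.                            *)
Definition positive (c : 'I_n) : bool := out K (over_right c).
Definition npos : nat := #|[set c | positive c]|.
Definition nneg : nat := #|[set c | ~~ positive c]|.

(* An immersed arc from the leg to the head is recorded by the darts d of the
   successive edges it crosses, with d chosen such that the arc passes from the
   left to the right of the edge followed from d to [edge d].                 *)
Fixpoint arc_from (r : 'I_(nregions K)) (alpha : seq D) : bool :=
  if alpha is d :: alpha' then
    (region K d == r) && arc_from (region K (edge K d)) alpha'
  else r == region K hdart.

Definition shortcut (alpha : seq D) : bool := arc_from (region K ldart) alpha.

(* States; the value true is 1. *)
Definition state : finType := {ffun 'I_n -> bool}.
Definition weight (s : state) : nat := #|[set c | s c]|.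

(* At a point other than an end, [join s d] is the dart to which d is connected
   in the smoothing s.  Rotating the overstrand 1-3 counterclockwise onto the
   understrand 0-2 sweeps the corners between 1 and 2 and between 3 and 0; the
   0-smoothing merges these, so it joins 0-1 and 2-3, and the 1-smoothing joins
   0-3 and 1-2.  The head is formally joined to the leg, which turns the
   segment component into a cycle.                                            *)
Definition join (s : state) (d : D) : D :=
  match d with
  | inl (inl (c, k)) => xdart m c (if odd k (+) s c then ord_pred k else ordS k)
  | inl (inr (i, b)) => mdart n i (~~ b)
  | inr e => inr (~~ e)
  end.

Definition strand (s : state) : rel D :=
  [rel x y | (y == edge K x) || (y == join s x)].

Definition ncomponents (s : state) : nat := n_comp (strand s) D.

(* The segment component of s, oriented from leg to head, runs along the edge
   of d from d to [edge d].                                                   *)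
Definition segment_out (s : state) (d : D) : bool :=
  fconnect (fun x => join s (edge K x)) ldart d.

Section Shortcut.
Variable alpha : seq D.

(* A curve following the edge from d to [edge d] crosses, from right to left,
   an arc that passes from the left to the right of that edge.                *)
Definition diagram_dot : int :=
  \sum_(d <- alpha) ((out K d)%:Z - (out K (edge K d))%:Z).

Definition segment_dot (s : state) : int :=
  \sum_(d <- alpha) ((segment_out s d)%:Z - (segment_out s (edge K d))%:Z).

Definition mu (s : state) : int := segment_dot s - diagram_dot.

(* The Turaev polynomial in the variables A, u, and in the variables q, u with
   q = - A^-2 (lemma turaev_AE below).  Laurent polynomials are evaluated at
   units of a commutative ring; an identity valid for all units of all
   commutative rings is an identity of Laurent polynomials over Z.            *)
Definition turaev_A (R : comUnitRingType) (A u : R) : R :=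
  (- A ^+ 3) ^ (- (npos%:Z - nneg%:Z)) * u ^ (- diagram_dot) *
  \sum_(s : state) A ^ (n%:Z - (2 * weight s)%N%:Z) * u ^ segment_dot s *
    (- A ^+ 2 - A ^- 2) ^+ (ncomponents s).-1.

Definition turaev (R : comUnitRingType) (q u : R) : R :=
  (-1) ^+ nneg * q ^ (npos%:Z - (2 * nneg)%N%:Z) *
  \sum_(s : state) u ^ mu s * (- q) ^+ weight s *
    (q + q^-1) ^+ (ncomponents s).-1.

Lemma npos_nneg : (npos + nneg = n)%N.
Proof.
rewrite /npos /nneg !cardsE -[RHS]card_ord -(cardC positive).
by congr (_ + _)%N; apply: eq_card => c; rewrite !inE.
Qed.

Lemma turaev_AE (R : comUnitRingType) (A u : R) :
  A \is a GRing.unit -> u \is a GRing.unit ->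
  turaev_A A u = turaev (- A ^- 2) u.
Proof.
move=> uA uu; rewrite /turaev_A /turaev !mulr_sumr; apply: eq_bigr => s _.
rewrite invrN invrK opprK [- A ^- 2 - A ^+ 2]addrC.
set x := _ ^+ (ncomponents s).-1.
rewrite /mu (exprzDr uu).
set y := u ^ segment_dot s; set z := u ^ (- diagram_dot).
have nE : (n%:Z = npos%:Z + nneg%:Z)%R by rewrite -PoszD npos_nneg.
rewrite nE -[- A ^+ 3]mulN1r -[- A ^- 2]mulN1r.
have u1 : (-1 : R) \is a GRing.unit by rewrite unitrN1.
have expMz (x0 y0 : R) (k : int) : x0 \is a GRing.unit -> y0 \is a GRing.unit ->
    (x0 * y0) ^ k = x0 ^ k * y0 ^ k.
  by move=> ux uy; apply: exprMz_comm => //; apply: mulrC.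
rewrite !(expMz (-1) _ _ u1) ?unitrV ?unitrX //.
have -> : A ^- 2 = A ^ (- 2%:Z) by [].
have -> : A ^+ 3 = A ^ 3%:Z by [].
rewrite [(A ^ (- 2%:Z)) ^+ _]exprnP !exprz_exp.
have sgnz (z0 : int) : (-1 : R) ^ z0 = (-1) ^+ `|z0|%N.
  by case: z0 => k //=; rewrite NegzE -exprz_inv invrN1.
pose e1 := (- (npos%:Z - nneg%:Z))%R.
have E1 : (-1 : R) ^ e1 = (-1) ^+ nneg * (-1) ^ (npos%:Z - (2 * nneg)%N%:Z).
  have -> : e1 = nneg%:Z + (- npos%:Z) by rewrite /e1 opprB addrC.
  have vN k : (-1 : R) ^ (- Posz k) = (-1) ^+ k by rewrite sgnz abszN.
  rewrite !exprzDr // !vN exprM sqrrN expr1n expr1n mulr1 //.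
rewrite -/e1 E1.
have E2 : A ^ (3%:Z * e1) * A ^ (npos%:Z + nneg%:Z - (2 * weight s)%N%:Z) =
  A ^ (- 2%:Z * (npos%:Z - (2 * nneg)%N%:Z)) * A ^ (- 2%:Z * (weight s)%:Z).
  rewrite -!exprzDr //; congr (_ ^ _); rewrite /e1; lia.
set a := (-1) ^+ nneg; set b := (-1) ^ _.
transitivity (a * b * z * y * x * (A ^ (3%:Z * e1) *
   A ^ (npos%:Z + nneg%:Z - (2 * weight s)%N%:Z))); first by ring.
by rewrite E2; ring.
Qed.

(* Winding homology.  The basis 1, X of the algebra Q[X]/(X^2) is written
   X^0, X^1 with exponents in bool.  The tensor product attached to a state s
   has as basis the labellings of the components of s by exponents that give
   the segment component the label X; a labelling is a function on the darts
   that is constant on each component.  The line of top degree forms on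
   s^-1(1) is identified with Q by the wedge product of its ordered basis.    *)
Definition labelling (s : state) (l : {ffun D -> bool}) : bool :=
  l ldart && [forall x, forall y, strand s x y ==> (l x == l y)].

Definition generator : finType :=
  {g : state * {ffun D -> bool} | labelling g.1 g.2}.

Definition gstate (g : generator) : state := (val g).1.
Definition glabel (g : generator) : {ffun D -> bool} := (val g).2.

Definition deg (b : bool) : int := if b then -1 else 1.

Definition gdeg (g : generator) : int :=
  \sum_(d | roots (strand (gstate g)) d) deg (glabel g d).

Definition igrading (g : generator) : int := (weight (gstate g))%:Z - nneg%:Z.
Definition qgrading (g : generator) : int :=
  gdeg g + igrading g + npos%:Z - nneg%:Z + 1.
Definition ugrading (g : generator) : int := mu (gstate g).
Definition grading (g : generator) : int * int * int :=
  (igrading g, qgrading g, ugrading g).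

(* The coefficient of X^c in X^a X^b, and of X^b (x) X^c in the coproduct of
   X^a, where 1 |-> 1 (x) X + X (x) 1 and X |-> X (x) X.                       *)
Definition mul_coef (a b c : bool) : rat := (a + b == c)%N%:R.
Definition comul_coef (a b c : bool) : rat := (b + c == a.+1)%N%:R.

Definition changed (s : state) (c : 'I_n) (d : D) : bool :=
  connect (strand s) (under_in c) d || connect (strand s) (under_out c) d.

(* The coefficient of g' in the image of g under the map f (x) id attached to
   the crossing c.  The darts 0 and 2 of c lie on distinct smoothing arcs of c
   in either state.  The maps for the segment component are the restrictions
   of those for closed components, its label being X.                         *)
Definition surgery_coef (c : 'I_n) (g g' : generator) : rat :=
  let s := gstate g in let l := glabel g in
  let s' := gstate g' in let l' := glabel g' in
  let one := connect (strand s) (under_in c) (under_out c) in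
  let one' := connect (strand s') (under_in c) (under_out c) in
  if [forall d, changed s c d || (l d == l' d)] then
    if ~~ one && one' then
      mul_coef (l (under_in c)) (l (under_out c)) (l' (under_in c))
    else if one && ~~ one' then
      comul_coef (l (under_in c)) (l' (under_in c)) (l' (under_out c))
    else 0
  else 0.

Definition set1_at (s : state) (c : 'I_n) : state :=
  [ffun x => (x == c) || s x].

(* The sign of the wedge product of c with the ordered basis of s^-1(1). *)
Definition wedge_sign (s : state) (c : 'I_n) : rat :=
  (-1) ^+ #|[set x : 'I_n | s x & (x < c)%N]|.

Definition diff_coef (g g' : generator) : rat :=
  \sum_(c | ~~ gstate g c && (gstate g' == set1_at (gstate g) c))
    wedge_sign (gstate g) c * surgery_coef c g g'.

Definition chains := {ffun generator -> rat^o}.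

Definition diff_fun (v : chains) : chains :=
  [ffun g' => \sum_(g : generator) diff_coef g g' * v g].

Lemma diff_fun_is_linear : linear diff_fun.
Proof.
move=> a v w; apply/ffunP => g'; rewrite !ffunE /GRing.scale /= mulr_sumr.
rewrite -big_split /=; apply: eq_bigr => g _.
by rewrite !ffunE mulrDr mulrCA.
Qed.

HB.instance Definition _ :=
  GRing.isLinear.Build rat chains chains _ diff_fun diff_fun_is_linear.

Definition diff : 'End(chains) := linfun diff_fun.

Definition gen_chain (g : generator) : chains := [ffun x => (x == g)%:R].

Definition graded_chains (i j k : int) : {vspace chains} :=
  <<[seq gen_chain g | g <- enum generator & grading g == (i, j, k)]>>%VS.

Definition cycles (i j k : int) : {vspace chains} :=
  (graded_chains i j k :&: lker diff)%VS.
Definition boundaries (i j k : int) : {vspace chains} :=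
  (diff @: graded_chains (i - 1) j k)%VS.

(* The quotient of the cycles by the boundaries is represented by a complement
   of the latter in the former.                                               *)
Definition betti (i j k : int) : nat :=
  \dim (cycles i j k :\: boundaries i j k)%VS.

(* The sum runs over the finitely many gradings in which there are chains. *)
Definition winding_poincare (R : comUnitRingType) (t q u : R) : R :=
  \sum_(x <- undup [seq grading g | g <- enum generator])
    t ^ x.1.1 * q ^ x.1.2 * u ^ x.2 * (betti x.1.1 x.1.2 x.2)%:R.

End Shortcut.
End Diagram.

(* Main.v *)
Require Import Defs.
From mathcomp Require Import all_boot all_order all_algebra all_fingroup.
From mathcomp Require Import zify ring.

Set Implicit Arguments.
Unset Strict Implicit.
Unset Printing Implicit Defensive.

Import Order.TTheory GRing.Theory Num.Theory.
Local Open Scope ring_scope.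

(** Both sides are sums over states, so the statement is that the graded Euler
    characteristic of a finite complex can be computed on chains.  For a complex
    whose differential preserves the q- and u-gradings, rank-nullity gives
    betti_i = dim Z_i - rank d_(i-1) and dim C_i = dim Z_i + rank d_i; with the
    sign (-1)^i the ranks cancel in the sum ([euler_characteristic]), and what is
    left is a sum over the generators.  Summing q^deg over the labellings of one
    state factors over its components and gives q^-1 (q + q^-1)^(|s| - 1)
    ([sum_labellings]), which is the Turaev state sum.

    The substance is that the chain groups do form such a complex: d^2 = 0, and d
    shifts the trigrading by (1, 0, 0).  Both need the topology of the sphere,
    which enters only through [index_function]: a flow on the edges of the diagram
    which is conserved at every vertex is the jump, from left to right, of a
    function on the regions.  This is the vanishing of H^1 and follows from
    Euler's formula by counting dimensions.

    A state is the union of the cycles obtained by alternating two fixed-point-free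
    involutions of the darts, the edges of the diagram and the smoothing arcs.  One
    traversal of a component gives a flow.  If the component is closed, its
    index function is constant along its left side, so that it cannot pass the two
    arcs of a smoothed crossing in incompatible directions; hence changing the
    smoothing of a crossing both of whose arcs lie on one closed component
    always divides it, and only the segment component can undergo a change that
    keeps the number of components ([single_cycle_segment]).  If a closed component
    merges into the segment component, or splits off it, the difference of the flows
    of the two segment components has an index function that takes the same value
    at the leg and at the head, so the intersection number with the shortcut is
    unchanged ([segment_dot_smoothing]).

    For d^2 = 0, the chains of a state form the quotient ring of
    Q[x_d : d a dart] by the squares x_d^2 and the differences x_d - x_e, for d and
    e on the same component, or rather the ideal generated by the class of the leg.
    A merging is the projection, a division is multiplication by x_a + x_b after
    lifting, where a and b lie on the two arcs of the crossing.  These maps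
    are linear over the polynomial ring, so the two ways around a square of
    changes need only be compared on the unit, multiplied by the class of the leg.
    There each way is a product of factors x_a + x_b, and a short comparison of the
    partitions into components shows that the products agree: the changes that keep
    the number of components contribute 0, and the only value they face
    is killed because it contains the square of the class of the leg
    ([surgeries_commute]).  The signs of the exterior algebra then turn commuting
    squares into anticommuting ones. *)

(** * Index functions on the sphere *)

Local Notation root := fingraph.root.

Section InvariantFunctions.
Variable D : finType.

Definition rowfun (f : D -> rat) : 'rV[rat]_#|D| := \row_j f (enum_val j).

Lemma rowfunE f x : rowfun f 0 (enum_rank x) = f x.
Proof. by rewrite mxE enum_rankK. Qed.

Lemma big_rank (R : nmodType) (F : D -> R) :
  \sum_(i < #|D|) F (enum_val i) = \sum_x F x.
Proof.
rewrite (reindex (@enum_rank D)) /=; last first.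
  by exists enum_val => x _; rewrite ?enum_rankK ?enum_valK.
by apply: eq_bigr => x _; rewrite enum_rankK.
Qed.

Variable r : rel D.
Hypothesis r_sym : connect_sym r.

(** The row space is the space of functions constant on the classes of [r];
    each row is the indicator of a class. *)
Definition class_mx : 'M[rat]_(#|roots r|, #|D|) :=
  \matrix_(i, j) (root r (enum_val j) == enum_val i)%:R.

Lemma mul_class_mx (v : 'rV_#|roots r|) x (Hx : roots r (root r x)) :
  (v *m class_mx) 0 (enum_rank x) = v 0 (enum_rank_in Hx (root r x)).
Proof.
rewrite mxE (bigD1 (enum_rank_in Hx (root r x))) //=.
rewrite mxE enum_rankK enum_rankK_in // eqxx mulr1 big1 ?addr0 // => i i_x.
rewrite mxE enum_rankK; case: eqP => [E|]; last by rewrite mulr0.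
by case/eqP: i_x; apply: enum_val_inj; rewrite enum_rankK_in.
Qed.

(** The matrix has the identity as its submatrix on the columns of the class
    representatives. *)
Lemma rank_class_mx : \rank class_mx = n_comp r D.
Proof.
have -> : n_comp r D = #|roots r|.
  by rewrite /n_comp_mem; apply: eq_card => x; rewrite !inE andbT.
apply/eqP/row_freeP.
exists (\matrix_(j, i) (enum_val j == enum_val i)%:R).
apply/matrixP => i k; rewrite !mxE.
rewrite (bigD1 (enum_rank (enum_val k))) //= !mxE enum_rankK eqxx mulr1.
rewrite big1 ?addr0 => [|j j_k]; last first.
  rewrite !mxE; have [E|] := eqVneq (enum_val j) (enum_val k).
    by case/eqP: j_k; rewrite -E enum_valK.
  by rewrite mulr0.
have /eqP -> : roots r (enum_val k) by exact: (enum_valP k).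
by rewrite (inj_eq enum_val_inj) eq_sym.
Qed.

Lemma sub_class_mx (f : D -> rat) :
  (forall x y, r x y -> f x = f y) -> (rowfun f <= class_mx)%MS.
Proof.
move=> fP; have fc x y : connect r x y -> f x = f y.
  case/connectP=> p; elim: p x => [x _ -> //|z p IH x] /= /andP[xz zp] E.
  by rewrite (fP _ _ xz); apply: IH.
apply/submxP; exists (\row_i f (enum_val i)).
apply/rowP => j; rewrite -[j]enum_valK rowfunE.
rewrite (mul_class_mx _ (roots_root r_sym _)) mxE enum_rankK_in ?roots_root //.
  by apply: fc; apply: connect_root.
exact: (roots_root r_sym).
Qed.

Lemma class_mx_invariant (v : 'rV_#|D|) : (v <= class_mx)%MS ->
  forall x y, r x y -> v 0 (enum_rank x) = v 0 (enum_rank y).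
Proof.
case/submxP=> w -> x y xy.
rewrite !(mul_class_mx _ (roots_root r_sym _)).
have E : root r x = root r y by apply/(fingraph.rootP r_sym); apply: connect1.
by congr (w 0 _); apply: enum_val_inj; rewrite !enum_rankK_in;
  try exact: (roots_root r_sym).
Qed.

End InvariantFunctions.

Section IndexFunction.
Variables (n m : nat) (K : pdcode n m).
Hypotheses (orK : oriented K) (spK : spherical K).
Local Notation D := (dart n m).

Lemma clockwise_inj : injective (@clockwise n m).
Proof.
pose ccw (d : D) : D := match d with
  | inl (inl (c, k)) => xdart m c (ordS k)
  | inl (inr (i, b)) => mdart n i (~~ b)
  | inr e => inr e
  end.
apply: (can_inj (g := ccw)) => -[[[c k]|[i b]]|e] //=.
  by rewrite ord_predK.
by rewrite negbK.
Qed.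

Lemma edge_inj : injective (edge K).
Proof. exact: inv_inj (edgeK orK). Qed.

Lemma piece_sym : connect_sym (piece_rel K).
Proof.
apply: sym_connect_sym => x y /=.
congr (_ || _); last by rewrite orbC.
by rewrite eq_sym (can2_eq (edgeK orK) (edgeK orK)).
Qed.

Lemma card_edges : (fcard (edge K) D * 2 = #|D|)%N.
Proof.
apply: (fcard_order_set edge_inj) => //; apply/subsetP => x _.
rewrite inE; apply/eqP; apply: (@order_cycle _ _ [:: x; edge K x]).
- by rewrite /= (edgeK orK) !eqxx.
- by rewrite /= inE eq_sym (negbTE (edge_neq orK x)).
- by rewrite inE eqxx.
Qed.

Let A := class_mx (frel (edge K)).
Let B := class_mx (frel (@clockwise n m)).
Let Z := kermx (col_mx A B)^T.

(** A flow is antisymmetric along edges iff it is orthogonal to all functions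
    constant on edges, and conserved iff it is orthogonal to all functions
    constant around each vertex.  So the flows form the orthogonal complement
    of a sum of two spaces of invariant functions. *)
Lemma mem_cycle_space (w : D -> rat) :
    (forall d, w (edge K d) = - w d) ->
    (forall f : D -> rat, (forall d, f (clockwise d) = f d) ->
       \sum_d w d * f d = 0) ->
  (rowfun w <= Z)%MS.
Proof.
move=> wN w0; apply/sub_kermxP; rewrite tr_col_mx mul_mx_row.
have symf (f : D -> D) (f_inj : injective f) : connect_sym (frel f).
  exact: fconnect_sym.
rewrite -[RHS]row_mx0; congr row_mx; apply/rowP => i; rewrite !mxE.
(* Reindexing by the edge involution changes the sign of the sum. *)
- have neg : \sum_d w d * (root (frel (edge K)) d == enum_val i)%:R = 0.
    have := erefl (\sum_d w d * (root (frel (edge K)) d == enum_val i)%:R).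
    rewrite {1}(reindex_inj edge_inj) /=.
    under eq_bigr => d _.
      rewrite wN mulNr.
      have -> : root (frel (edge K)) (edge K d) = root (frel (edge K)) d.
        by apply/esym/(fingraph.rootP (symf _ edge_inj)); apply: fconnect1.
      over.
    by rewrite sumrN => /esym/eqP; rewrite -addr_eq0 -mulr2n mulrn_eq0 => /eqP.
  rewrite -[RHS]neg -(@big_rank D); apply: eq_bigr => j _.
  by rewrite !mxE.
- rewrite -[RHS](w0 (fun d => (root (frel (@clockwise n m)) d == enum_val i)%:R)).
    by rewrite -(@big_rank D); apply: eq_bigr => j _; rewrite !mxE.
  move=> d; congr (_ == _)%:R.
  by apply/esym/(fingraph.rootP (symf _ clockwise_inj)); apply: fconnect1.
Qed.

(** With V, E, F, P the numbers of vertices, edges, faces and pieces, the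
    complement has dimension 2E - (E + V - P), because a function that is both
    edge- and vertex-invariant is constant on pieces.  Euler's formula makes
    this F - P, and the tree of pieces and regions makes it the number of
    regions minus one. *)
Lemma rank_cycle_space : (\rank Z <= (nregions K).-1)%N.
Proof.
rewrite mxrank_ker mxrank_tr -addsmxE.
have := mxrank_sum_cap A B.
rewrite !rank_class_mx.
have : (\rank (A :&: B) <= npieces K)%N.
  rewrite /npieces -(rank_class_mx (piece_rel K)).
  apply: mxrankS; apply/row_subP => i.
  have [vA vB] : (row i (A :&: B)%MS <= A)%MS /\ (row i (A :&: B)%MS <= B)%MS.
    by split; apply: submx_trans (row_sub _ _) _; rewrite ?capmxSl ?capmxSr.
  set v := row i _ in vA vB *.
  have -> : v = rowfun (fun d => v 0 (enum_rank d)).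
    by apply/rowP => j; rewrite [RHS]mxE enum_valK.
  have vAP := class_mx_invariant (fconnect_sym edge_inj) vA.
  have vBP := class_mx_invariant (fconnect_sym clockwise_inj) vB.
  apply: (sub_class_mx piece_sym) => x y /or3P[] /eqP ->.
  - by apply: vAP => /=.
  - by apply: vBP => /=.
  - by apply/esym; apply: vBP => /=.
have := card_edges; have := planar_pieces spK; have := region_tree spK.
set e := fcard _ _; set f := fcard _ _; set p := npieces K; set v := fcard _ _.
set a := \rank (A :&: B); set b := \rank (A + B).
move: (rank_leq_col (A + B)%MS); rewrite -/b; move: e f p v a b => *.
lia.
Qed.

Definition coboundary_mx : 'M[rat]_(nregions K, #|D|) :=
  \matrix_(r, j) ((region K (enum_val j) == r)%:R -
                  (region K (edge K (enum_val j)) == r)%:R).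

Lemma mul_coboundary (h : 'rV_(nregions K)) d :
  (h *m coboundary_mx) 0 (enum_rank d) =
    h 0 (region K d) - h 0 (region K (edge K d)).
Proof.
rewrite mxE; under eq_bigr do rewrite mxE enum_rankK mulrBr.
rewrite sumrB; congr (_ - _).
  rewrite (bigD1 (region K d)) //= eqxx mulr1 big1 ?addr0 // => r.
  by rewrite eq_sym => /negbTE ->; rewrite mulr0.
rewrite (bigD1 (region K (edge K d))) //= eqxx mulr1 big1 ?addr0 // => r.
by rewrite eq_sym => /negbTE ->; rewrite mulr0.
Qed.

Lemma region_clockwise d : region K (clockwise d) = region K (edge K d).
Proof. by rewrite -(region_face spK (edge K d)) /face (edgeK orK). Qed.

(** A function on the regions with zero coboundary takes the same value on
    both sides of each edge, hence is constant because the sphere is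
    connected. *)
Lemma rank_coboundary : ((nregions K).-1 <= \rank coboundary_mx)%N.
Proof.
have : (\rank (kermx coboundary_mx) <= 1)%N.
  suff /mxrankS : (kermx coboundary_mx <= (const_mx 1 : 'rV_(nregions K)))%MS.
    by move/leq_trans; apply; apply: rank_leq_row.
  apply/row_subP => i; set h := row i _.
  have h0 : h *m coboundary_mx = 0 by rewrite -row_mul mulmx_ker row0.
  move: h h0 => h h0.
  have hE d : h 0 (region K (edge K d)) = h 0 (region K d).
    apply/esym/eqP; rewrite -subr_eq0 -mul_coboundary h0 mxE //.
  have hC x y : h 0 (region K x) = h 0 (region K y).
    have /connectP[p] := region_connected spK x y.
    elim: p x => [x _ -> //|z p IH x] /= /andP[xz zp] E.
    rewrite -(IH _ zp E); case/orP: xz => [/or3P[]/eqP->|/eqP-> //].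
    - by rewrite hE.
    - by rewrite region_clockwise hE.
    - by rewrite region_clockwise hE.
  apply/submxP; exists (const_mx (h 0 (region K ldart))).
  apply/rowP => r; rewrite [RHS]mxE big_ord1 !mxE mulr1.
  by have [d <-] := region_onto spK r; rewrite -(hC d ldart).
by rewrite mxrank_ker; move: (\rank _) => k; lia.
Qed.

(** The vanishing of H^1 of the sphere: coboundaries of functions on the
    regions are flows, and the two spaces have the same dimension. *)
Lemma index_function (w : D -> rat) :
    (forall d, w (edge K d) = - w d) ->
    (forall f : D -> rat, (forall d, f (clockwise d) = f d) ->
       \sum_d w d * f d = 0) ->
  exists h : 'I_(nregions K) -> rat,
    forall d, w d = h (region K d) - h (region K (edge K d)).
Proof.
move=> wN w0; have wZ := mem_cycle_space wN w0.
have cZ : (coboundary_mx <= Z)%MS.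
  apply/row_subP => r.
  have -> : row r coboundary_mx = rowfun (fun d =>
      (region K d == r)%:R - (region K (edge K d) == r)%:R).
    by apply/rowP => j; rewrite !mxE.
  apply: mem_cycle_space => [d|f fP]; first by rewrite (edgeK orK) opprB.
  under eq_bigr do rewrite mulrBl.
  rewrite sumrB (reindex_inj clockwise_inj) /= -sumrB big1 // => d _.
  by rewrite fP region_clockwise subrr.
have : (Z <= coboundary_mx)%MS.
  rewrite -(mxrank_leqif_sup cZ) eqn_leq (mxrankS cZ) /=.
  exact: leq_trans rank_cycle_space rank_coboundary.
move/(submx_trans wZ)/submxP => [h E].
by exists (h 0) => d; rewrite -mul_coboundary -E rowfunE.
Qed.

End IndexFunction.

(** * Curves made of two involutions *)

Lemma connect_rel_ind (T : finType) (r R : rel T) :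
  reflexive R -> transitive R -> subrel r R -> subrel (connect r) R.
Proof.
move=> R_refl R_tr rR x _ /connectP[p + ->].
elim: p x => [x _|y p IHp x /= /andP[xy yp]]; first exact: R_refl.
exact: R_tr (rR _ _ xy) (IHp _ yp).
Qed.

Section TwoInvolutions.
Variables (D : finType) (e j : D -> D).
Hypotheses (eK : involutive e) (jK : involutive j).
Hypotheses (e_neq : forall x, e x != x) (j_neq : forall x, j x != x).

(** One step along a curve: traverse the edge of [x], then the smoothing arc
    at its other end. *)
Definition walk x := j (e x).
Definition alternating : rel D := [rel x y | (y == e x) || (y == j x)].

Lemma walk_inj : injective walk.
Proof. by move=> x y /(inv_inj jK) /(inv_inj eK). Qed.

Lemma walk_sym x y : fconnect walk x y = fconnect walk y x.
Proof. exact: (fconnect_sym walk_inj). Qed.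

Lemma walkE x : walk (e (j x)) = x.
Proof. by rewrite /walk eK jK. Qed.

(** A walk never returns along an edge in the opposite direction: otherwise,
    at the middle of the path, one of the two involutions would fix a dart. *)
Lemma walk_oriented x : ~~ fconnect walk x (e x).
Proof.
suff iterN k y : iter k walk y != e y.
  by apply/negP => /iter_findex /eqP; rewrite (negbTE (iterN _ _)).
elim/ltn_ind: k y => -[|[|k]] IHk y.
- by rewrite eq_sym.
- exact: j_neq.
apply: contra_neq (IHk k (leqnSn _) (walk y)); rewrite iterS iterSr => E.
by apply: (inv_inj eK); apply: (inv_inj jK); rewrite eK jK.
Qed.

Lemma alternating_sym : connect_sym alternating.
Proof.
apply: sym_connect_sym => x y; rewrite /alternating /=.
by rewrite eq_sym (can2_eq eK eK) [y == j x]eq_sym (can2_eq jK jK).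
Qed.

(** A component consists of one orbit of the walk together with the opposite
    ends of its edges, which form the same curve followed backwards. *)
Lemma connect_alternating x y :
  connect alternating x y = fconnect walk x y || fconnect walk x (e y).
Proof.
have step z : connect alternating z (walk z).
  by apply: (@connect_trans _ _ (e z)); apply: connect1;
    rewrite /alternating /= eqxx ?orbT.
have walk_sub : subrel (fconnect walk) (connect alternating).
  apply: connect_rel_ind => [z|z1 z2 z3|z1 z2 /eqP <- //].
    exact: connect0.
  exact: connect_trans.
apply/idP/orP => [|[/walk_sub //|/walk_sub xy]]; last first.
  by apply: connect_trans xy (connect1 _); rewrite /alternating /= eK eqxx.
have closed_xy z t : alternating z t ->
    fconnect walk x z || fconnect walk x (e z) ->
    fconnect walk x t || fconnect walk x (e t).
  case/orP=> /eqP ->; first by rewrite eK orbC.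
  case/orP=> [xz|xz]; apply/orP.
    right; apply: connect_trans xz _.
    by rewrite walk_sym -{2}[z]walkE; apply: fconnect1.
  left; apply: connect_trans xz _.
  by rewrite -{2}[z]eK; apply: fconnect1.
case/connectP=> p xp ->; apply/orP.
pose meets z := fconnect walk x z || fconnect walk x (e z).
have : meets x by rewrite /meets connect0.
rewrite -/(meets _); elim: p {1 2 3}x xp => [|t p IHp] z //=.
by case/andP=> /closed_xy zt /IHp tp /zt/tp.
Qed.

End TwoInvolutions.

Section PermutationOrbits.
Variable D : finType.
Implicit Types (t : {perm D}) (x y z : D).

Lemma porbit_fconnect (f : D -> D) (f_inj : injective f) x y :
  (y \in porbit (perm f_inj) x) = fconnect f x y.
Proof.
have E i : (perm f_inj ^+ i)%g x = iter i f x.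
  by rewrite permX; elim: i => //= i ->; rewrite permE.
apply/idP/idP => [/porbitP[i ->]|/iter_findex <-].
  by rewrite E fconnect_iter.
by rewrite -E mem_porbit.
Qed.

(** A permutation changes its number of cycles by one when multiplied by a
    transposition, so that the transposition either divides a cycle or joins
    two. *)
Lemma porbit_mul_tperm t x y : x != y ->
  (y \in porbit (t * tperm x y)%g x) = (y \notin porbit t x).
Proof.
move=> xy; rewrite -porbitV invMg tpermV -[porbit t x]porbitV.
have := porbits_mul_tperm t^-1 x y.
have := porbits_mul_tperm (tperm x y * t^-1)%g x y.
rewrite /= mulgA tperm2 mul1g xy ![x \in porbit _ y]porbit_sym.
by do 2!case: (_ \in _) => //=; lia.
Qed.

Lemma porbit_mul_tperm_out t x y z : x \notin porbit t z -> y \notin porbit t z ->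
  porbit (t * tperm x y)%g z = porbit t z.
Proof.
move=> xz yz.
have E i : ((t * tperm x y) ^+ i)%g z = (t ^+ i)%g z.
  elim: i => [|i IHi]; first by rewrite !expg0.
  have tE : t ((t ^+ i)%g z) = (t ^+ i.+1)%g z by rewrite expgSr permM.
  rewrite expgSr !permM IHi tE tpermD //.
    by apply: contraNneq xz => ->; rewrite mem_porbit.
  by apply: contraNneq yz => ->; rewrite mem_porbit.
by apply/setP => u; apply/porbitP/porbitP => -[i ->]; exists i; rewrite E.
Qed.

End PermutationOrbits.

(** Exchanging the partners of [a] and [b] multiplies the walk by the
    transpositions of [a], [b] and of [p], [r].  The orbit of [a] avoids [p]
    and [r], so only the first of them affects it. *)
Lemma walk_switch (D : finType) (e j j' : D -> D) (a b p r : D) :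
    involutive e -> involutive j -> involutive j' -> uniq [:: a; b; p; r] ->
    j a = p -> j b = r -> j' a = r -> j' b = p ->
    (forall x, x \notin [:: a; b; p; r] -> j' x = j x) ->
    ~~ fconnect (walk e j) a p -> ~~ fconnect (walk e j) a r ->
  fconnect (walk e j') a b = ~~ fconnect (walk e j) a b.
Proof.
move=> eK jK jK' abpr ja jb ja' jb' j_off.
rewrite -!(porbit_fconnect (walk_inj eK jK)) -(porbit_fconnect (walk_inj eK jK')).
set s := perm _; set s' := perm _ => pa ra.
have [[ab ap ar] [bp br] pr] : [/\ [/\ a != b, a != p & a != r],
    b != p /\ b != r & p != r].
  move: abpr; rewrite /= !inE !negb_or !andbT.
  by case/and3P=> /and3P[-> -> ->] /andP[-> ->] ->.
suff -> : s' = (s * tperm p r * tperm a b)%g.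
  by rewrite porbit_mul_tperm // porbit_mul_tperm_out.
apply/permP => x; rewrite !permM.
rewrite (permE (walk_inj eK jK)) (permE (walk_inj eK jK')) /walk; move: (e x) => z.
have [/eqP <-|az] := boolP (a == z).
  by rewrite ja ja' tpermL tpermD.
have [/eqP <-|bz] := boolP (b == z).
  by rewrite jb jb' tpermR tpermD // eq_sym.
have jp : j p = a by rewrite -ja jK.
have jr : j r = b by rewrite -jb jK.
have jp' : j' p = b by rewrite -jb' jK'.
have jr' : j' r = a by rewrite -ja' jK'.
have [/eqP <-|pz] := boolP (p == z).
  by rewrite jp jp' (@tpermD _ p r a) 1?eq_sym ?tpermL.
have [/eqP <-|rz] := boolP (r == z).
  by rewrite jr jr' (@tpermD _ p r b) 1?eq_sym ?tpermR.
rewrite j_off; last by rewrite !inE ![z == _]eq_sym !negb_or az bz pz rz.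
have jz u v : j u = v -> u != z -> v != j z.
  by move=> <-; rewrite (inj_eq (inv_inj jK)).
rewrite [tperm p r _]tpermD ?tpermD //; first [exact: (jz p) | exact: (jz r)
  | exact: (jz a) | exact: (jz b)].
Qed.

(** * Changing the smoothing of one crossing *)

Section Smoothings.
Variables (n m : nat) (K : pdcode n m).
Hypothesis orK : oriented K.
Local Notation D := (dart n m).
Implicit Types (s : state n) (c : 'I_n) (x y : D).

Definition at_crossing c x :=
  if x is inl (inl (c', _)) then c' == c else false.

Definition same_component s : rel D := connect (strand K s).

Lemma joinK s : involutive (@join n m s).
Proof.
case=> [[[c k]|[i b]]|[]] //=; last by rewrite negbK.
by case: (s c); case: k => -[|[|[|[|k]]]] // ki; congr (inl (inl (_, _)));
  apply: val_inj.
Qed.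

Lemma join_neq s x : join s x != x.
Proof.
case: x => [[[c k]|[i b]]|b] /=.
- by case: (s c); case: k => -[|[|[|[|k]]]] // ki; apply/eqP => -[].
- by apply/eqP => -[]; case: b.
- by case: b.
Qed.

Lemma join_under_in s c :
  join s (under_in c) = if s c then over_left c else over_right c :> D.
Proof. by rewrite /=; case: (s c); congr (inl (inl (_, _))); apply: val_inj. Qed.

Lemma join_under_out s c :
  join s (under_out c) = if s c then over_right c else over_left c :> D.
Proof. by rewrite /=; case: (s c); congr (inl (inl (_, _))); apply: val_inj. Qed.

Lemma at_crossingP c x :
  at_crossing c x = (x \in [:: under_in c; under_out c; over_right c; over_left c]).
Proof.
rewrite !inE; case: x => [[[c' [k ki]]|[i b]]|b] //=.
rewrite /under_in /over_right /under_out /over_left /xdart.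
rewrite !(inj_eq (inl_inj)) !xpair_eqE.
by case: (c' == c) => //=; move: k ki => [|[|[|[|k]]]].
Qed.

Lemma at_crossing_join s c x : at_crossing c (join s x) = at_crossing c x.
Proof. by case: x => [[[c' k]|[i b]]|[]]. Qed.

Lemma join_off s s' c x : (forall c', c' != c -> s' c' = s c') ->
  ~~ at_crossing c x -> join s' x = join s x.
Proof. by move=> ss'; case: x => [[[c' k]|[i b]]|[]] //= /ss' ->. Qed.

Lemma same_component_sym s : symmetric (same_component s).
Proof. exact: alternating_sym (edgeK orK) (joinK s). Qed.

Lemma same_component_refl s : reflexive (same_component s).
Proof. by move=> x; apply: connect0. Qed.

Lemma same_component_trans s : transitive (same_component s).
Proof. by move=> x; apply: connect_trans. Qed.

Lemma same_component_edge s x : same_component s x (edge K x).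
Proof. by apply: connect1; rewrite /strand /= eqxx. Qed.

Lemma same_component_join s x : same_component s x (join s x).
Proof. by apply: connect1; rewrite /strand /= eqxx orbT. Qed.

Lemma changedE s c x : changed K s c x =
  same_component s (under_in c) x || same_component s (under_out c) x.
Proof. by []. Qed.

Lemma changed_at_crossing s c x : at_crossing c x -> changed K s c x.
Proof.
rewrite at_crossingP !inE changedE.
have := same_component_join s (under_in c); rewrite join_under_in.
have := same_component_join s (under_out c); rewrite join_under_out.
have := same_component_refl s (under_in c).
have := same_component_refl s (under_out c).
by case: (s c) => H0 H1 H2 H3; case/or4P => /eqP ->; rewrite ?H0 ?H1 ?H2 ?H3 ?orbT.
Qed.

Definition merged s c : rel D := [rel x y | same_component s x y ||
  (changed K s c x && changed K s c y)].

Lemma changed_trans s c x y : same_component s x y ->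
  changed K s c x = changed K s c y.
Proof.
move=> xy; rewrite !changedE.
have E z : same_component s z x = same_component s z y.
  apply/idP/idP => [zx|zy]; first exact: same_component_trans zx xy.
  by apply: same_component_trans zy _; rewrite same_component_sym.
by rewrite !E.
Qed.

(** Smoothings that differ only at [c] have the same arcs elsewhere, and all
    darts at [c] are identified in [merged]. *)
Lemma merged_sub s s' c : (forall c', c' != c -> s' c' = s c') ->
  subrel (same_component s') (merged s c).
Proof.
move=> ss'; apply: connect_rel_ind => [x|y x z|x y]; rewrite /merged /=.
- by rewrite same_component_refl.
- case/orP=> [xy|/andP[cx cy]] /orP[yz|/andP[cy' cz]].
  + by rewrite (same_component_trans xy yz).
  + by rewrite (changed_trans c xy) cy' cz orbT.
  + by rewrite -(changed_trans c yz) cx cy orbT.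
  + by rewrite cx cz orbT.
case/orP=> /eqP ->; first by rewrite same_component_edge.
have [cx|cx] := boolP (at_crossing c x).
  by rewrite !changed_at_crossing ?at_crossing_join ?orbT.
by rewrite (join_off ss' cx) same_component_join.
Qed.

(** If the arcs of [s'] at [c] lie on one component, gluing along [c] changes
    nothing for [s']; but the glued partition does not depend on the smoothing
    of [c]. *)
Lemma same_component_switch s s' c : (forall c', c' != c -> s' c' = s c') ->
  same_component s' (under_in c) (under_out c) -> same_component s' =2 merged s c.
Proof.
move=> ss' ab x y; apply/idP/idP; first exact: merged_sub.
have ss : subrel (same_component s) (same_component s').
  move=> z t /(merged_sub (fun c' c'c => esym (ss' c' c'c))).
  have cE u : changed K s' c u -> same_component s' (under_in c) u.
    by rewrite changedE => /orP[//|]; apply: same_component_trans.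
  rewrite /merged /= => /orP[//|/andP[/cE zc /cE tc]].
  by apply: same_component_trans tc; rewrite same_component_sym.
have cE u : changed K s c u -> same_component s' (under_in c) u.
  by rewrite changedE => /orP[/ss//|/ss]; apply: same_component_trans.
rewrite /merged /= => /orP[/ss//|/andP[/cE xc /cE yc]].
by apply: same_component_trans yc; rewrite same_component_sym.
Qed.

Lemma set1_at_off s c c' : c' != c -> set1_at s c c' = s c'.
Proof. by rewrite ffunE => /negbTE ->. Qed.

Lemma set1_at_in s c : set1_at s c c.
Proof. by rewrite ffunE eqxx. Qed.

Lemma component_walk s x y : same_component s x y =
  fconnect (walk (edge K) (join s)) x y ||
  fconnect (walk (edge K) (join s)) x (edge K y).
Proof. exact: connect_alternating (edgeK orK) (joinK s) x y. Qed.

Lemma crossing_switch s c : ~~ s c ->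
  let orbit s := fconnect (walk (edge K) (join s)) (under_in c) in
  ~~ orbit s (over_right c) -> ~~ orbit s (over_left c) ->
  orbit (set1_at s c) (under_out c) = ~~ orbit s (under_out c).
Proof.
move=> sc orbit; apply: walk_switch; first exact: edgeK.
- exact: joinK.
- exact: joinK.
- by rewrite /= !inE /under_in /over_right /under_out /over_left /xdart
    !(inj_eq inl_inj) !xpair_eqE !eqxx.
- by rewrite join_under_in (negbTE sc).
- by rewrite join_under_out (negbTE sc).
- by rewrite join_under_in set1_at_in.
- by rewrite join_under_out set1_at_in.
move=> x cx; apply: (join_off (c := c)) => [c' /set1_at_off //|].
by rewrite at_crossingP.
Qed.

Lemma join_not_in_orbit s x :
  ~~ fconnect (walk (edge K) (join s)) x (join s x).
Proof.
have wi := walk_sym (edgeK orK) (joinK s).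
rewrite wi; apply: contra (walk_oriented (edgeK orK) (joinK s) (edge_neq orK)
  (join_neq s) (edge K x)).
rewrite (edgeK orK); apply: connect_trans.
by apply: connect1; rewrite /= /walk (edgeK orK).
Qed.

(** The orbits of the two arcs, being distinct, are joined by the
    transposition in [walk_switch]. *)
Lemma one_component_after s c : ~~ s c ->
  ~~ same_component s (under_in c) (under_out c) ->
  same_component (set1_at s c) (under_in c) (under_out c).
Proof.
move=> sc ab; rewrite component_walk crossing_switch //.
- by apply/orP; left; apply: contra ab; rewrite component_walk => ->.
- have := join_not_in_orbit s (under_in c).
  by rewrite join_under_in (negbTE sc).
- apply: contra ab => ar.
  have : same_component s (under_in c) (over_left c) by rewrite component_walk ar.
  move=> H; apply: same_component_trans H _; rewrite same_component_sym.
  by have := same_component_join s (under_out c); rewrite join_under_out (negbTE sc).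
Qed.

End Smoothings.

(** * Sums over the components of a state *)

Lemma sum_roots_class (T : finType) (r : rel T) (V : nmodType) (F : T -> V) a :
  connect_sym r ->
  \sum_(x | roots r x && connect r a x) F x = F (root r a).
Proof.
move=> r_sym; apply: big_pred1 => x; rewrite /=.
apply/andP/eqP => [[/eqP xr /(fingraph.rootP r_sym) ax]|->].
  by rewrite ax xr.
by rewrite roots_root ?connect_root.
Qed.

Section ComponentSums.
Variables (n m : nat) (K : pdcode n m).
Hypothesis orK : oriented K.
Local Notation D := (dart n m).
Variables (s s' : state n) (c : 'I_n).
Hypothesis ss' : forall c', c' != c -> s' c' = s c'.
Hypothesis ab : ~~ same_component K s (under_in c) (under_out c).
Hypothesis ab' : same_component K s' (under_in c) (under_out c).

Lemma changed_merged x : changed K s c x = same_component K s' (under_in c) x.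
Proof.
rewrite (same_component_switch orK ss' ab') /merged /=.
rewrite [changed K s c (under_in c)]changedE same_component_refl /=.
by rewrite changedE; case: same_component.
Qed.

(** Components that avoid the crossing are the same in both states and even
    have the same representatives, since the representative of a class depends
    only on the class. *)
Lemma sum_components_merge (V : nmodType) (F F' : D -> V) :
    (forall x y, same_component K s x y -> F x = F y) ->
    (forall x y, same_component K s' x y -> F' x = F' y) ->
    (forall x, ~~ changed K s c x -> F' x = F x) ->
  \sum_(x | roots (strand K s') x) F' x + (F (under_in c) + F (under_out c)) =
  \sum_(x | roots (strand K s) x) F x + F' (under_in c).
Proof.
move=> FE F'E FF'.
have sym t : connect_sym (strand K t) by exact: same_component_sym.
rewrite (bigID (changed K s c)) [in RHS](bigID (changed K s c)) /=.
have -> : \sum_(x | roots (strand K s') x && changed K s c x) F' x =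
    F' (under_in c).
  rewrite (F'E _ (root (strand K s') (under_in c))) ?connect_root//.
    rewrite -(sum_roots_class _ _ (sym s')).
    by apply: eq_bigl => x; rewrite changed_merged.
  exact: (connect_root (strand K s')).
have -> : \sum_(x | roots (strand K s) x && changed K s c x) F x =
    F (under_in c) + F (under_out c).
  rewrite (FE _ _ (connect_root (strand K s) (under_in c))).
  rewrite (FE _ _ (connect_root (strand K s) (under_out c))).
  rewrite -!(sum_roots_class _ _ (sym s)).
  rewrite (bigID (same_component K s (under_in c))) /=; congr (_ + _).
    apply: eq_bigl => x; rewrite changedE -andbA; congr (_ && _).
    by rewrite /same_component; case: connect; rewrite ?andbF.
  apply: eq_bigl => x; rewrite changedE -andbA; congr (_ && _).
  have : ~~ (same_component K s (under_in c) x && same_component K s (under_out c) x).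
    apply: contra ab => /andP[ax bx]; apply: same_component_trans ax _.
    by rewrite same_component_sym.
  by rewrite /same_component; do 2!case: connect.
suff -> : \sum_(x | roots (strand K s') x && ~~ changed K s c x) F' x =
    \sum_(x | roots (strand K s) x && ~~ changed K s c x) F x.
  by rewrite [LHS]addrC -[RHS]addrA; congr (_ + _); apply: addrC.
apply: congr_big => // [x|x /andP[_ /FF' //]].
case Kx: (changed K s c x); rewrite ?andbF ?andbT //=.
rewrite /roots /=; congr (_ == _); congr (odflt _ _); apply: eq_pick => y.
have := same_component_switch orK ss' ab' x y.
by rewrite /merged /= Kx orbF.
Qed.

Lemma ncomponents_merge : ncomponents K s = (ncomponents K s').+1.
Proof.
have nE t : ncomponents K t = (\sum_(x | roots (strand K t) x) 1)%N.
  by rewrite sum1_card; apply: eq_card => x; rewrite !inE andbT.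
have := @sum_components_merge nat (fun=> 1%N) (fun=> 1%N).
move=> /(_ (fun _ _ _ => erefl) (fun _ _ _ => erefl) (fun _ _ => erefl)) E.
have {}E : (ncomponents K s' + 2 = ncomponents K s + 1)%N by rewrite !nE.
lia.
Qed.

End ComponentSums.

(** When the arcs lie on one component in both smoothings, the set of darts of
    every component is unchanged; only the order in which the darts are passed
    differs. *)
Lemma same_component_single n m (K : pdcode n m) (s s' : state n) c : oriented K ->
    (forall c', c' != c -> s' c' = s c') ->
    same_component K s (under_in c) (under_out c) ->
    same_component K s' (under_in c) (under_out c) ->
  same_component K s' =2 same_component K s.
Proof.
move=> orK ss' ab ab' x y; rewrite (same_component_switch orK ss' ab') /merged /=.
have cE z : changed K s c z = same_component K s (under_in c) z.
  rewrite changedE; apply/orP/idP => [[//|]|]; last by left.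
  exact: same_component_trans.
rewrite !cE; case E: (same_component K s x y) => //=.
apply/negP => /andP[ax ay]; move/negP: E; apply.
by apply: same_component_trans ay; rewrite same_component_sym.
Qed.

(** * Planarity of closed components *)

Lemma fconnect_ind (T : finType) (f : T -> T) (P : pred T) x y :
  (forall z, P z -> P (f z)) -> fconnect f x y -> P x -> P y.
Proof. by move=> Pf /iter_findex <- Px; elim: findex => //= k /Pf. Qed.

Section Flows.
Variables (n m : nat) (K : pdcode n m).
Hypotheses (orK : oriented K) (spK : spherical K).
Local Notation D := (dart n m).
Implicit Types (s : state n) (c : 'I_n) (x y : D).
Local Notation follow s := (walk (edge K) (join s)).

(** The signed passage of a set of oriented edges, the orientation being
    recorded by the dart at which an edge is left. *)
Definition flow (S : pred D) x : rat := (S x)%:R - (S (edge K x))%:R.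

Lemma flowN S x : flow S (edge K x) = - flow S x.
Proof. by rewrite /flow (edgeK orK) opprB. Qed.

Lemma clockwise_join s x : x != ldart -> x != hdart ->
  join s x = clockwise x \/ x = clockwise (join s x).
Proof.
case: x => [[[c k]|[i b]]|[]] //= _ _; last by left.
by case: ifP => _; [left | right; rewrite ordSK].
Qed.

(** A closed walk enters a vertex as often as it leaves it.  Only the formal
    join of the head to the leg does not take place at one vertex, whence the
    boundary term. *)
Lemma sum_flow s (S : pred D) (f : D -> rat) :
    (forall x, S (follow s x) = S x) -> (forall x, f (clockwise x) = f x) ->
  \sum_x flow S x * f x =
    ((S ldart)%:R - (S hdart)%:R) * (f ldart - f hdart).
Proof.
move=> SE fE; rewrite /flow; under eq_bigr do rewrite mulrBl.
rewrite sumrB; have -> : \sum_x (S (edge K x))%:R * f x =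
    \sum_x (S x)%:R * f (join s x).
  rewrite [RHS](reindex_inj (inv_inj (@joinK n m s))); apply: eq_bigr => x _ /=.
  by rewrite joinK -SE /walk (edgeK orK).
rewrite -sumrB (bigD1 ldart) //= (bigD1 hdart) //= big1 ?addr0.
  by ring.
move=> x /andP[xl xh]; rewrite -mulrBr.
suff -> : f (join s x) = f x by rewrite subrr mulr0.
by case: (clockwise_join s xl xh) => [->|{2}->]; rewrite fE.
Qed.

(** A smoothing arc turns into an adjacent corner, so the curve keeps on one
    of its sides the same region of the diagram. *)
Lemma follow_regions s x : edge K x != ldart -> edge K x != hdart ->
  region K (follow s x) = region K x \/
  region K (edge K (follow s x)) = region K (edge K x).
Proof.
move=> xl xh; rewrite /walk; case: (clockwise_join s xl xh) => [->|E].
  by left; rewrite region_clockwise // (edgeK orK).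
by right; rewrite [in RHS]E region_clockwise.
Qed.

Lemma orbit_follow s x y : fconnect (follow s) x (follow s y) = fconnect (follow s) x y.
Proof.
apply/idP/idP => xy; last exact: connect_trans xy (fconnect1 _ _).
apply: connect_trans xy _; rewrite (walk_sym (edgeK orK) (@joinK n m s)).
exact: fconnect1.
Qed.

Lemma orbit_edge s x y : fconnect (follow s) x y -> ~~ fconnect (follow s) x (edge K y).
Proof.
move=> xy; apply: contra (walk_oriented (edgeK orK) (@joinK n m s)
  (edge_neq orK) (@join_neq n m s) y).
by apply: connect_trans; rewrite (walk_sym (edgeK orK) (@joinK n m s)).
Qed.

Lemma orbit_join s x y :
  fconnect (follow s) x (join s y) = fconnect (follow s) x (edge K y).
Proof. by rewrite -[RHS]orbit_follow /walk (edgeK orK). Qed.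

(** The index function of a closed curve has a constant value on the left of
    the curve.  If the curve left the crossing by [under_in] and arrived by
    [under_out], two of the corners at the crossing would be on its left
    although their indices differ by one. *)
Lemma closed_curve_coherent s c :
    same_component K s (under_in c) (under_out c) ->
    ~~ same_component K s (under_in c) ldart ->
  fconnect (follow s) (under_in c) (under_out c).
Proof.
set a := under_in c; set b := under_out c => ab al.
set S : pred D := fconnect (follow s) a.
have Sa : S a by exact: connect0.
have cS x : S x -> same_component K s a x by rewrite component_walk /S // => ->.
have cSe x : S (edge K x) -> same_component K s a x.
  by rewrite component_walk /S // orbC => ->.
have ah : ~~ same_component K s a hdart.
  apply: contra al => ah; apply: same_component_trans ah _.
  exact: (same_component_join K s hdart).
have notE x y : same_component K s a x -> ~~ same_component K s a y -> x != y.
  by move=> ax; apply: contraNneq => <-.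
have [h hE] : exists h : 'I_(nregions K) -> rat,
    forall x, flow S x = h (region K x) - h (region K (edge K x)).
  apply: index_function => // [x|f fE]; first exact: flowN.
  rewrite (sum_flow (s := s)) //; last by move=> x; apply: orbit_follow.
  have -> : S ldart = false by apply/negbTE; apply: contra al; apply: cS.
  have -> : S hdart = false by apply/negbTE; apply: contra ah; apply: cS.
  by rewrite subrr mul0r.
have flow1 x : S x -> flow S x = 1.
  move=> Sx; have /negbTE Sex : ~~ S (edge K x) by exact: orbit_edge.
  by rewrite /flow Sx Sex subr0.
have left_const x : S x -> h (region K x) = h (region K a).
  move=> Sx; suff : S x && (h (region K x) == h (region K a)).
    by case/andP=> _ /eqP.
  apply: (@fconnect_ind _ (follow s) (fun z => S z && (h (region K z) ==
    h (region K a))) a x) => [z|//|]; last by rewrite Sa eqxx.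
  case/andP=> Sz /eqP <-.
  have Sfz : S (follow s z) by rewrite /S orbit_follow.
  rewrite Sfz /=.
  have zl : edge K z != ldart by apply: notE al; apply: cSe; rewrite (edgeK orK).
  have zh : edge K z != hdart by apply: notE ah; apply: cSe; rewrite (edgeK orK).
  case: (follow_regions s zl zh) => [->//|E].
  have := hE z; have := hE (follow s z); rewrite !flow1 // E => -> /(addIr _) ->.
  by rewrite eqxx.
(* The corner on the left of a dart is separated by the edge of that dart from the
   corner on the left of the next dart clockwise, so two successive darts by which
   the curve leaves contradict [left_const]. *)
apply: contraT => Sb.
have Seb : S (edge K b).
  by move: ab; rewrite component_walk // => /orP[|//]; move: Sb => /negP.
have Sjb : S (join s b) by rewrite /S orbit_join.
have cwE x : S x -> h (region K x) = 1 + h (region K (clockwise x)).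
  by move=> Sx; rewrite region_clockwise // -(flow1 _ Sx) hE subrK.
have contra1 x : S x -> S (clockwise x) -> False.
  move=> Sx Scx; have := cwE x Sx; rewrite !left_const // => /eqP.
  by rewrite -subr_eq subrr.
case sc: (s c) in Sjb; move: Sjb; rewrite join_under_out sc => Sj.
  case: (contra1 (over_right c)) => //; suff -> : clockwise (over_right c) = a by [].
  by congr (inl (inl (_, _))); apply: val_inj.
case: (contra1 a) => //; suff -> : clockwise a = over_left c by [].
by congr (inl (inl (_, _))); apply: val_inj.
Qed.

(** On a closed component both smoothings would be traversed coherently, so
    that the two orbits would consist of the same darts and differ by one
    transposition; this is impossible by the parity of the number of cycles. *)
Lemma single_cycle_segment s c : ~~ s c ->
    same_component K s (under_in c) (under_out c) ->
    same_component K (set1_at s c) (under_in c) (under_out c) ->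
  same_component K s (under_in c) ldart.
Proof.
move=> sc ab ab'; apply: contraT => al.
have Sb := closed_curve_coherent ab al.
have al' : ~~ same_component K (set1_at s c) (under_in c) ldart.
  by rewrite (same_component_single (c := c) orK _ ab ab') // => c' /set1_at_off.
have := closed_curve_coherent ab' al'; rewrite crossing_switch ?Sb //.
  have := join_not_in_orbit orK s (under_in c).
  by rewrite join_under_in (negbTE sc).
have := orbit_edge Sb; rewrite -orbit_join.
by rewrite join_under_out (negbTE sc).
Qed.

End Flows.

(** * The segment component and the shortcut *)

Section SegmentDot.
Variables (n m : nat) (K : pdcode n m).
Hypotheses (orK : oriented K) (spK : spherical K).
Local Notation D := (dart n m).
Local Notation follow s := (walk (edge K) (join s)).
Variables (s s' : state n) (c : 'I_n).
Hypothesis ss' : forall c', c' != c -> s' c' = s c'.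
Hypothesis ab : ~~ same_component K s (under_in c) (under_out c).

Lemma segment_follow t x : segment_out K t (follow t x) = segment_out K t x.
Proof. exact: orbit_follow. Qed.

Lemma segment_edge t x : segment_out K t x -> ~~ segment_out K t (edge K x).
Proof. exact: orbit_edge. Qed.

Lemma crossing_component x y : at_crossing c x -> at_crossing c y ->
  same_component K s x y -> y = x \/ y = join s x.
Proof.
have crossE z : at_crossing c z -> exists2 e, e = under_in c \/ e = under_out c &
    z = e \/ z = join s e.
  rewrite at_crossingP !inE => /or4P[] /eqP ->.
  - by exists (under_in c); [left | left].
  - by exists (under_out c); [right | left].
  - case sc: (s c); [exists (under_out c) | exists (under_in c)]; auto;
      by right; rewrite ?join_under_in ?join_under_out sc.
  - case sc: (s c); [exists (under_in c) | exists (under_out c)]; auto;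
      by right; rewrite ?join_under_in ?join_under_out sc.
move=> /crossE[e He ze] /crossE[e' He' ye'] xy.
have eE z u : z = u \/ z = join s u -> same_component K s u z.
  by case=> ->; rewrite ?same_component_refl ?same_component_join.
have ee' : same_component K s e e'.
  apply: same_component_trans (eE _ _ ze) _; apply: same_component_trans xy _.
  by rewrite same_component_sym // eE.
have Ee : e' = e.
  case: He He' ee' => -> [] -> //; first by rewrite (negbTE ab).
  by rewrite same_component_sym // (negbTE ab).
case: ze ye' => -> []->; rewrite Ee; auto.
by right; rewrite joinK.
Qed.

(** The segment component contains at most one of the two arcs at [c], and it
    passes this arc once and in one direction. *)
Lemma segment_crossing_uniq x y : segment_out K s x -> segment_out K s y ->
  at_crossing c (edge K x) -> at_crossing c (edge K y) -> x = y.
Proof.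
move=> sx sy cx cy; have [|E|E] := crossing_component cx cy.
- have lE z : segment_out K s z -> same_component K s ldart (edge K z).
    by move=> sz; rewrite component_walk // (edgeK orK); apply/orP; right.
  by apply: same_component_trans (lE _ sy); rewrite same_component_sym // lE.
- exact/esym/(edge_inj orK).
have := segment_edge sy; rewrite E.
by have := segment_follow s x; rewrite /walk => ->; rewrite sx.
Qed.

(** After the change of smoothing the segment makes a detour at [c] and
    returns: the two orbits through the leg use the same steps except at the
    unique passage of [c].  Depending on whether that passage survives, either
    the common part or the missing part of the old orbit is closed under
    steps. *)
Lemma segment_sub x : segment_out K s x -> segment_out K s' x.
Proof.
have follow_off y : ~~ at_crossing c (edge K y) -> follow s' y = follow s y.
  by move=> cy; rewrite /walk (join_off ss' cy).
have s'E y : ~~ at_crossing c (edge K y) ->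
    segment_out K s' (follow s y) = segment_out K s' y.
  by move=> cy; rewrite -(segment_follow s' y) follow_off.
(* t is the place where the segment of s reaches the crossing. *)
have [/existsP[t /and3P[st ct s't]] | none] := boolP [exists t,
    [&& segment_out K s t, at_crossing c (edge K t) & ~~ segment_out K s' t]].
  pose P y := segment_out K s y && segment_out K s' y.
  have : P t.
    apply: (@fconnect_ind _ (follow s) P ldart t) => [y /andP[sy s'y]|//|].
      rewrite /P segment_follow sy s'E //.
      by apply: contra s't => cy; rewrite (segment_crossing_uniq st sy).
    by rewrite /P /segment_out !connect0.
  by rewrite /P (negbTE s't) andbF.
move=> sx; apply: contraT => s'x.
pose P y := segment_out K s y && ~~ segment_out K s' y.
have : P ldart.
  apply: (@fconnect_ind _ (follow s) P x) => [y /andP[sy s'y]||]; last 2 first.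
  - by rewrite (walk_sym (edgeK orK) (@joinK n m s)).
  - by rewrite /P sx.
  rewrite /P segment_follow sy s'E //.
  by apply: contra none => cy; apply/existsP; exists y; rewrite sy cy.
by rewrite /P /segment_out !connect0.
Qed.

Lemma sum_arc (h : 'I_(nregions K) -> rat) r (alpha : seq D) : arc_from r alpha ->
  \sum_(x <- alpha) (h (region K x) - h (region K (edge K x))) =
    h r - h (region K hdart).
Proof.
elim: alpha r => [|x alpha IH] r /=; first by move/eqP->; rewrite big_nil subrr.
by case/andP=> /eqP <- /IH E; rewrite big_cons E subrKA.
Qed.

Lemma segment_dotE t alpha :
  (segment_dot K alpha t)%:~R = \sum_(x <- alpha) flow K (segment_out K t) x.
Proof.
rewrite /segment_dot rmorph_sum; apply: eq_bigr => x _ /=.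
by rewrite rmorphB.
Qed.

(** The difference of the flows of the two segment components is conserved at
    the leg and the head as well, hence has an index function.  It vanishes
    along the segment of [s], so the index is the same on both sides of it and
    constant from the leg to the head; summing the jumps along the shortcut
    gives 0. *)
Lemma segment_dot_smoothing alpha : shortcut K alpha ->
  segment_dot K alpha s' = segment_dot K alpha s.
Proof.
move=> short; apply/eqP; rewrite -(eqr_int rat) -subr_eq0 !segment_dotE -sumrB.
pose z x := flow K (segment_out K s') x - flow K (segment_out K s) x.
have seg_h t : segment_out K t hdart = false.
  by apply/negbTE; have := join_not_in_orbit orK t ldart.
have seg_l t : segment_out K t ldart by exact: connect0.
have [h hE] : exists h : 'I_(nregions K) -> rat,
    forall x, z x = h (region K x) - h (region K (edge K x)).
  apply: index_function => // [x|f fE].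
    by rewrite /z !flowN // [RHS]opprD.
  rewrite /z; under eq_bigr do rewrite mulrBl.
  rewrite sumrB (sum_flow orK (segment_follow s') fE).
  rewrite (sum_flow orK (segment_follow s) fE).
  by rewrite !seg_h !seg_l subrr.
have z0 x : segment_out K s x -> h (region K (edge K x)) = h (region K x).
  move=> sx; apply/esym/eqP; rewrite -subr_eq0 -hE /z /flow sx segment_sub //.
  by rewrite !(negbTE (segment_edge _)) ?segment_sub // subrr.
have left_const x : segment_out K s x -> h (region K x) = h (region K ldart).
  move=> sx; suff : segment_out K s x && (h (region K x) == h (region K ldart)).
    by case/andP=> _ /eqP.
  apply: (@fconnect_ind _ (follow s) (fun y => segment_out K s y &&
    (h (region K y) == h (region K ldart))) ldart x) => [y|//|]; last first.
    by rewrite seg_l eqxx.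
  case/andP=> sy /eqP hy; rewrite segment_follow sy /=.
  have [E|yl] := eqVneq (edge K y) ldart.
    by have := segment_edge sy; rewrite E seg_l.
  have [E|yh] := eqVneq (edge K y) hdart.
    by have -> : follow s y = ldart by rewrite /walk E.
  case: (follow_regions orK spK s yl yh) => [->|E]; first by rewrite hy.
  by rewrite -z0 ?segment_follow // E z0 // hy.
under eq_bigr do rewrite -/(z _) hE.
rewrite (sum_arc _ short) -(edgeK orK hdart) z0.
  by rewrite left_const ?subrr // -segment_follow /walk (edgeK orK).
by rewrite -segment_follow /walk (edgeK orK).
Qed.

End SegmentDot.

(** * The Frobenius algebra of a partition *)

Section FrobeniusSurgery.
Variable D : finType.
Local Notation label := {ffun D -> bool}.
Implicit Types (E : rel D) (a b d x y : D) (l : label) (v w : label -> rat).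

Definition equivalence E := [/\ reflexive E, symmetric E & transitive E].

Definition glue E a b : rel D :=
  [rel x y | E x y || ((E a x || E b x) && (E a y || E b y))].

(** Labellings constant on the classes of [E] stand for the monomials in the
    classes: the value true is a factor X.  A chain is the family of its
    coefficients, so that maps are written by their action on coefficients,
    that is, contravariantly. *)
Definition labels E l := forall x y, E x y -> l x = l y.
Definition eq_on E v w := forall l, labels E l -> v l = w l.

Definition unlabel E d l : label := [ffun x => l x && ~~ E d x].

(** Multiplication by the class of [d]: the coefficient of a monomial
    divisible by this class is read off at the quotient, and squares vanish. *)
Definition mulX E d v : label -> rat := fun l => if l d then v (unlabel E d l) else 0.
(** Multiplication on the factors of [a] and [b]; an X in the product comes
    from either factor. *)
Definition merge E a b v : label -> rat := fun l =>
  if l a then v (unlabel E a l) + v (unlabel E b l) else v l.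
(** Comultiplication on the factor of [a] and [b]. *)
Definition split E a b v : label -> rat := fun l =>
  if l a && l b then v l else if l a || l b then v (unlabel E a l) else 0.
Definition step E E' a b v : label -> rat :=
  if ~~ E a b && E' a b then merge E a b v
  else if E a b && ~~ E' a b then split E a b v else fun=> 0.

(** Either of the two partitions is the gluing of the other as soon as it has
    [a] and [b] in one class; this covers merging, division and the change
    that keeps the partition. *)
Record surgery (E E' : rel D) a b : Prop := Surgery {
  surgery_eq : equivalence E;
  surgery_eq' : equivalence E';
  surgery_merge : E' a b -> E' =2 glue E a b;
  surgery_split : E a b -> E =2 glue E' a b }.

Section OneSurgery.
Variables (E E' : rel D) (a b : D).
Hypothesis EE' : surgery E E' a b.

Lemma eqv_l E0 x y z : equivalence E0 -> E0 x y -> E0 x z = E0 y z.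
Proof.
case=> _ Es Et xy; apply/idP/idP; last exact: Et xy.
by apply: Et; rewrite Es.
Qed.

(** The merging map is the projection onto a quotient ring, hence linear. *)
Lemma merge_mulX d v : ~~ E a b -> E' a b ->
  eq_on E' (merge E a b (mulX E d v)) (mulX E' d (merge E a b v)).
Proof.
move=> ab ab' l lE'; have eqE := surgery_eq EE'; have [Er Es Et] := eqE.
have E'E x y : E' x y = E x y || ((E a x || E b x) && (E a y || E b y)).
  exact: surgery_merge EE' ab' x y.
have lb : l b = l a by apply/esym/lE'.
have lK x : E a x || E b x -> l x = l a.
  by move=> Kx; apply/esym/lE'; rewrite E'E Er Kx orbT.
rewrite /merge /mulX.
case la: (l a).
  rewrite !ffunE.
  have [ad|ad] := boolP (E a d).
    have ld : l d by rewrite lK ?ad.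
    have bd : E b d = false.
      by apply: contraNF ab => bd; rewrite (eqv_l _ eqE ad) Es.
    rewrite ld bd /= add0r.
    have -> : E' d a by rewrite E'E /= Es ad.
    rewrite andbF; congr v; apply/ffunP => y; rewrite !ffunE E'E /=.
    by rewrite ad /= -(eqv_l y eqE ad); case: (l y); case: (E a y); case: (E b y).
  have [bd|bd] := boolP (E b d).
    have ld : l d by rewrite lK ?bd ?orbT.
    rewrite ld /= addr0.
    have -> : E' d a by rewrite E'E /= bd Er !orbT.
    rewrite andbF; congr v; apply/ffunP => y; rewrite !ffunE E'E /=.
    by rewrite bd orbT /= -(eqv_l y eqE bd); case: (l y); case: (E a y); case: (E b y).
  rewrite !andbT; case ld: (l d); last by rewrite addr0.
  have E'd y : E' d y = E d y by rewrite E'E (negbTE ad) (negbTE bd) /= orbF.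
  rewrite la E'd Es (negbTE ad) /=.
  by congr (v _ + v _); apply/ffunP => y; rewrite !ffunE E'd andbAC.
case ld: (l d) => //.
rewrite ?ffunE la /=; congr v; apply/ffunP => y; rewrite !ffunE E'E /=.
case Kd: (E a d || E b d); rewrite ?orbF //.
by move: (lK _ Kd); rewrite ld la.
Qed.

(** The division map is multiplication by x_a + x_b after lifting to the finer
    partition, which is well defined because (x_a - x_b)(x_a + x_b) = x_a^2 -
    x_b^2 = 0; hence it is linear. *)
Lemma split_mulX d v : E a b -> ~~ E' a b ->
  eq_on E' (split E a b (mulX E d v)) (mulX E' d (split E a b v)).
Proof.
move=> ab ab' l lE'; have eqE := surgery_eq' EE'; have [Er Es Et] := eqE.
have E'E x y : E x y = E' x y || ((E' a x || E' b x) && (E' a y || E' b y)).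
  exact: surgery_split EE' ab x y.
have aK y : E a y = E' a y || E' b y.
  by rewrite E'E /= Er; case: (E' a y); case: (E' b y).
have lE x y : E' x y -> l y = l x by move=> xy; apply/esym/lE'.
have dE x y : E' x d -> E' d y = E' x y by move=> xd; rewrite (eqv_l y eqE xd).
rewrite /split /mulX; have [ad|ad] := boolP (E' a d).
  have bd : E' b d = false.
    by apply: contraNF ab' => bd; rewrite (eqv_l _ eqE ad) Es.
  have Ead : E a d by rewrite aK ad.
  rewrite !ffunE (lE _ _ ad) Ead !(dE a) // Er (negbTE ab') andbF /=.
  case: (l a); case: (l b) => //=; congr v; apply/ffunP => y.
  rewrite !ffunE aK E'E ad /= (dE a) //.
  by case: (l y); case: (E' a y); case: (E' b y).
have [bd|bd] := boolP (E' b d).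
  have Ead : E a d by rewrite aK bd orbT.
  have ba : E' b a = false by rewrite Es; apply/negbTE.
  rewrite !ffunE (lE _ _ bd) Ead !(dE b) // Er ba andbF /=.
  case: (l a); case: (l b) => //=; congr v; apply/ffunP => y.
  rewrite !ffunE aK E'E bd orbT /= (dE b) //.
  by case: (l y); case: (E' a y); case: (E' b y).
have Ed y : E d y = E' d y by rewrite E'E (negbTE ad) (negbTE bd) /= orbF.
rewrite !ffunE aK (negbTE ad) (negbTE bd) [E' d a]Es [E' d b]Es (negbTE ad) (negbTE bd).
rewrite !andbT.
have uE : unlabel E d l = unlabel E' d l by apply/ffunP => y; rewrite !ffunE Ed.
have uC : unlabel E d (unlabel E a l) = unlabel E a (unlabel E' d l).
  by apply/ffunP => y; rewrite !ffunE Ed andbAC.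
by rewrite uE uC; case: (l d); case: (l a); case: (l b).
Qed.

End OneSurgery.

End FrobeniusSurgery.

Section SurgerySquares.
Variable D : finType.
Local Notation label := {ffun D -> bool}.
Implicit Types (E : rel D) (a b d x y : D) (l : label) (v w : label -> rat).

Lemma unlabel_labels E d l : equivalence E -> labels E l -> labels E (unlabel E d l).
Proof.
move=> eqE lE x y xy; have [_ Es _] := eqE.
by rewrite !ffunE (lE _ _ xy) ![E d _]Es (eqv_l d eqE xy).
Qed.

Lemma mulX_eq_on E d v w : equivalence E -> eq_on E v w ->
  eq_on E (mulX E d v) (mulX E d w).
Proof. by move=> eqE vw l lE; rewrite /mulX vw //; apply: unlabel_labels. Qed.

Lemma eq_on_sym E v w : eq_on E v w -> eq_on E w v.
Proof. by move=> vw l lE; rewrite vw. Qed.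

Lemma eq_on_trans E v w u : eq_on E v w -> eq_on E w u -> eq_on E v u.
Proof. by move=> vw wu l lE; rewrite vw // wu. Qed.

Lemma mulXC E d d' v : equivalence E ->
  eq_on E (mulX E d (mulX E d' v)) (mulX E d' (mulX E d v)).
Proof.
move=> [Er Es Et] l lE; rewrite /mulX !ffunE [E d' d]Es.
have -> : unlabel E d' (unlabel E d l) = unlabel E d (unlabel E d' l).
  by apply/ffunP => y; rewrite !ffunE andbAC.
by case: (l d); case: (l d'); case: (E d d').
Qed.

Lemma mulXX E d v : reflexive E -> mulX E d (mulX E d v) =1 fun=> 0.
Proof. by move=> Er l; rewrite /mulX !ffunE Er andbF if_same. Qed.

Lemma mulX_class E d d' v : equivalence E -> E d d' ->
  eq_on E (mulX E d v) (mulX E d' v).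
Proof.
move=> eqE dd' l lE; rewrite /mulX (lE _ _ dd').
by congr (if _ then v _ else _); apply/ffunP => y; rewrite !ffunE (eqv_l y eqE dd').
Qed.

Lemma mulXD E d v w :
  mulX E d (fun l => v l + w l) =1 fun l => mulX E d v l + mulX E d w l.
Proof. by move=> l; rewrite /mulX; case: ifP; rewrite ?addr0. Qed.

Lemma mulX0 E d : mulX E d (fun=> 0) =1 fun=> 0.
Proof. by move=> l; rewrite /mulX if_same. Qed.

Section Step.
Variables (E E' : rel D) (a b : D).
Hypothesis EE' : surgery E E' a b.

Lemma step_mulX d v :
  eq_on E' (step E E' a b (mulX E d v)) (mulX E' d (step E E' a b v)).
Proof.
move=> l lE'; rewrite /step; case: ifP => [/andP[ab ab']|_].
  exact: (merge_mulX EE').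
case: ifP => [/andP[ab ab']|_]; first exact: (split_mulX EE').
by rewrite mulX0.
Qed.

Lemma step_eq_on v w : eq_on E v w ->
  eq_on E' (step E E' a b v) (step E E' a b w).
Proof.
move=> vw l lE'; have eqE := surgery_eq EE'; rewrite /step.
case: ifP => [/andP[_ ab']|_].
  have lE : labels E l.
    by move=> x y xy; apply: lE'; rewrite (surgery_merge EE') // /glue /= xy.
  by rewrite /merge !vw //; apply: unlabel_labels.
case: ifP => [/andP[ab ab']|//].
have E'E x y : E x y = E' x y || ((E' a x || E' b x) && (E' a y || E' b y)).
  exact: (surgery_split EE' ab).
have lK x : E' a x || E' b x -> l x = l a \/ l x = l b.
  by case/orP => [/lE'|/lE'] ->; [left | right].
rewrite /split; case: ifP => [/andP[la lb]|lab].
  apply: vw => x y; rewrite E'E => /orP[/lE'//|/andP[/lK + /lK]].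
  by rewrite la lb => -[->|->] [->|->].
case: ifP => // _; apply: vw => x y xy; rewrite !ffunE.
have eqE' := surgery_eq' EE'; have [Er Es Et] := eqE.
rewrite ![E a _]Es (eqv_l a eqE xy); have [ya|ya] := boolP (E y a).
  by rewrite !andbF.
congr (_ && _); apply: lE'; move: xy; rewrite E'E => /orP[//|/andP[_ Ky]].
case/negP: ya; have [Er' _ _] := eqE'; by rewrite Es E'E Er' Ky orbT.
Qed.

Lemma stepD v w : step E E' a b (fun l => v l + w l) =1
  fun l => step E E' a b v l + step E E' a b w l.
Proof.
move=> l; rewrite /step /merge /split.
by case: ifP => _; [case: ifP => _ //; rewrite addrACA |
  do 3?[case: ifP => _ //]; rewrite addr0].
Qed.

Lemma step0 : step E E' a b (fun=> 0) =1 fun=> 0.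
Proof.
move=> l; rewrite /step; case: ifP => _; first by rewrite /merge addr0 if_same.
by case: ifP => _ //; rewrite /split !if_same.
Qed.

Definition unit_chain : label -> rat := fun l => (l == [ffun=> false])%:R.

(** Multiplication by x_a + x_b, the image of the unit under a division. *)
Definition handle (E0 : rel D) a0 b0 v : label -> rat :=
  fun l => mulX E0 a0 v l + mulX E0 b0 v l.

(** The operator by which a change from [E0] to [E0'] acts on the unit,
    transported to the ring of a later partition [E1]. *)
Definition factor (E0 E0' : rel D) a0 b0 (E1 : rel D) v : label -> rat :=
  if ~~ E0 a0 b0 && E0' a0 b0 then v
  else if E0 a0 b0 && ~~ E0' a0 b0 then handle E1 a0 b0 v
  else fun=> 0.

Lemma step_one : eq_on E' (step E E' a b unit_chain) (factor E E' a b E' unit_chain).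
Proof.
move=> l lE'; rewrite /step /factor.
have [Er' Es' Et'] := surgery_eq' EE'.
have unl0 (E0 : rel D) d x : E0 d x = false -> l x ->
    (unlabel E0 d l == [ffun=> false]) = false.
  move=> dx lx; apply/negbTE/eqP => /ffunP /(_ x).
  by rewrite !ffunE lx dx.
have l0 x : l x -> (l == [ffun=> false]) = false.
  by move=> lx; apply/negbTE/eqP => /ffunP /(_ x); rewrite !ffunE lx.
case: ifP => [/andP[ab ab']|_].
  rewrite /merge /unit_chain; case la: (l a) => //.
  have lb : l b by rewrite -(lE' _ _ ab').
  have [Er Es Et] := surgery_eq EE'.
  have ba : E b a = false by rewrite Es; apply/negbTE.
  by rewrite (l0 a) // (unl0 _ a b) ?(negbTE ab) // (unl0 _ b a) // addr0.
case: ifP => [/andP[ab ab']|//].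
have E'E x y : E x y = E' x y || ((E' a x || E' b x) && (E' a y || E' b y)).
  exact: (surgery_split EE' ab).
have aK x : E a x = E' a x || E' b x.
  by rewrite E'E Er'; case: (E' a x); case: (E' b x).
rewrite /split /handle /mulX /unit_chain.
have ba : E' b a = false by rewrite Es'; apply/negbTE.
case la: (l a); case lb: (l b) => /=; rewrite ?addr0 ?add0r //.
- by rewrite (l0 a) // (unl0 _ a b) ?(negbTE ab') // (unl0 _ b a) // addr0.
- congr (_ == _)%:R; apply/ffunP => y; rewrite !ffunE aK negb_or.
  case by_: (E' b y); rewrite ?andbT ?andbF //.
  by rewrite -(lE' _ _ by_) lb.
- congr (_ == _)%:R; apply/ffunP => y; rewrite !ffunE aK negb_or.
  case ay: (E' a y); rewrite ?andbT ?andbF //.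
  by rewrite -(lE' _ _ ay) la.
Qed.

(** Linearity carries the factor of an earlier change through a later one. *)
Lemma step_factor E0 E0' a0 b0 v :
  eq_on E' (step E E' a b (factor E0 E0' a0 b0 E v))
           (factor E0 E0' a0 b0 E' (step E E' a b v)).
Proof.
move=> l lE'; rewrite /factor; case: ifP => // _; case: ifP => _.
  by rewrite /handle stepD !step_mulX.
by rewrite step0.
Qed.

End Step.

Lemma factor_eq_on E0 E0' a b E v w : equivalence E -> eq_on E v w ->
  eq_on E (factor E0 E0' a b E v) (factor E0 E0' a b E w).
Proof.
move=> eqE vw l lE; rewrite /factor; case: ifP => _; first exact: vw.
by case: ifP => // _; rewrite /handle !(mulX_eq_on _ eqE vw).
Qed.

End SurgerySquares.

(** The changes that occur in states of diagrams on the sphere.  The marked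
    dart [o] stands for the segment component, and [k], [k'] are the numbers
    of components; their difference rules out most combinations of changes
    around a square. *)
Record curve_surgery (D : finType) (E E' : rel D) (a b o : D) (k k' : nat) : Prop :=
  CurveSurgery {
    curve_surgeryW : surgery E E' a b;
    surgery_connects : E a b || E' a b;
    surgery_single : E a b -> E' a b -> E a o;
    surgery_count : (k' + ~~ E a b = k + ~~ E' a b)%N }.

Lemma surgery_single_eq (D : finType) (E E' : rel D) a b :
  surgery E E' a b -> E a b -> E' a b -> E' =2 E.
Proof.
move=> W ab ab' x y; rewrite (surgery_merge W ab') /glue /=.
have [eqE _ _ _] := W; have [_ Es Et] := eqE.
rewrite -!(eqv_l _ eqE ab) !orbb; case xy: (E x y) => //=.
apply: contraFF xy => /andP[ax ay].
by rewrite -(eqv_l y eqE ax).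
Qed.

Section CommutingSquare.
Variable D : finType.
Local Notation label := {ffun D -> bool}.
Variables (E0 E1 E2 E3 : rel D) (a b a' b' o : D) (k0 k1 k2 k3 : nat).
Hypothesis S01 : curve_surgery E0 E1 a b o k0 k1.
Hypothesis S13 : curve_surgery E1 E3 a' b' o k1 k3.
Hypothesis S02 : curve_surgery E0 E2 a' b' o k0 k2.
Hypothesis S23 : curve_surgery E2 E3 a b o k2 k3.
Implicit Types (v w : label -> rat) (l : label).

Let W01 := curve_surgeryW S01.
Let W13 := curve_surgeryW S13.
Let W02 := curve_surgeryW S02.
Let W23 := curve_surgeryW S23.
Let eq3 := surgery_eq' W13.

Let path1 v := step E1 E3 a' b' (step E0 E1 a b v).
Let path2 v := step E2 E3 a b (step E0 E2 a' b' v).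

Lemma path1_mulX d v : eq_on E3 (path1 (mulX E0 d v)) (mulX E3 d (path1 v)).
Proof.
apply: eq_on_trans (step_eq_on W13 (step_mulX W01 d v)) _.
exact: step_mulX.
Qed.

Lemma path2_mulX d v : eq_on E3 (path2 (mulX E0 d v)) (mulX E3 d (path2 v)).
Proof.
apply: eq_on_trans (step_eq_on W23 (step_mulX W02 d v)) _.
exact: step_mulX.
Qed.

Lemma path1_one : eq_on E3 (path1 (@unit_chain D))
  (factor E0 E1 a b E3 (factor E1 E3 a' b' E3 (@unit_chain D))).
Proof.
apply: eq_on_trans (step_eq_on W13 (step_one W01)) _.
apply: eq_on_trans (step_factor W13 _ _ _ _ _) _.
exact: factor_eq_on eq3 (step_one W13).
Qed.

Lemma path2_one : eq_on E3 (path2 (@unit_chain D))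
  (factor E0 E2 a' b' E3 (factor E2 E3 a b E3 (@unit_chain D))).
Proof.
apply: eq_on_trans (step_eq_on W23 (step_one W02)) _.
apply: eq_on_trans (step_factor W23 _ _ _ _ _) _.
exact: factor_eq_on eq3 (step_one W23).
Qed.

Lemma handle_class v x y x' y' : E3 x x' -> E3 y y' ->
  eq_on E3 (handle E3 x y v) (handle E3 x' y' v).
Proof.
by move=> xx yy l lE; rewrite /handle (mulX_class v eq3 xx lE) (mulX_class v eq3 yy lE).
Qed.

Lemma handleC_args v x y : handle E3 x y v =1 handle E3 y x v.
Proof. by move=> l; rewrite /handle addrC. Qed.

Lemma handle_comm x y x' y' v : eq_on E3 (handle E3 x y (handle E3 x' y' v))
  (handle E3 x' y' (handle E3 x y v)).
Proof.
move=> l lE; rewrite /handle !mulXD.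
rewrite (mulXC x x' v eq3 lE) (mulXC x y' v eq3 lE).
rewrite (mulXC y x' v eq3 lE) (mulXC y y' v eq3 lE).
by rewrite addrACA.
Qed.

Lemma mulX_handle_marked x y v : E3 o x -> E3 o y ->
  eq_on E3 (mulX E3 o (handle E3 x y v)) (fun=> 0).
Proof.
move=> ox oy l lE; have [Er _ _] := eq3.
rewrite /handle mulXD !(mulXC o _ v eq3 lE).
rewrite -(mulX_class _ eq3 ox lE) -(mulX_class _ eq3 oy lE).
by rewrite !mulXX // addr0.
Qed.

Lemma sub13 : E3 a' b' -> subrel E1 E3.
Proof. by move=> ab' x y xy; rewrite (surgery_merge W13) // /glue /= xy. Qed.

Lemma sub23 : E3 a b -> subrel E2 E3.
Proof. by move=> ab x y xy; rewrite (surgery_merge W23) // /glue /= xy. Qed.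

Lemma handle0 x y : handle E3 x y (fun=> 0) =1 fun=> 0.
Proof. by move=> l; rewrite /handle !mulX0 addr0. Qed.

(** A change that keeps the number of components concerns the segment, so both
    classes are the marked one and the marked square vanishes. *)
Lemma handle_single13 v : E1 a' b' -> E3 a' b' ->
  eq_on E3 (mulX E3 o (handle E3 a' b' v)) (fun=> 0).
Proof.
have [_ Es Et] := eq3 => ab' ab3; have := surgery_single S13 ab' ab3.
move/(sub13 ab3); rewrite Es => oa.
exact: mulX_handle_marked oa (Et _ _ _ oa ab3).
Qed.

Lemma handle_single23 v : E2 a b -> E3 a b ->
  eq_on E3 (mulX E3 o (handle E3 a b v)) (fun=> 0).
Proof.
have [_ Es Et] := eq3 => ab2 ab3; have := surgery_single S23 ab2 ab3.
move/(sub23 ab3); rewrite Es => oa.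
exact: mulX_handle_marked oa (Et _ _ _ oa ab3).
Qed.

(** If the second change divides a component and also separates the arcs of
    the first crossing, then both crossings join the same two components, and
    the two sums x_a + x_b coincide. *)
Lemma handle_split_same v : E1 a b -> ~~ E3 a b -> E1 a' b' ->
  eq_on E3 (handle E3 a' b' v) (handle E3 a b v).
Proof.
move=> ab nab ab'; move: ab; rewrite (surgery_split W13 ab') /glue /= (negbTE nab) /=.
have [_ Es _] := eq3.
case/andP=> /orP[a'a|b'a] /orP[a'b|b'b].
- by case/negP: nab; rewrite -(eqv_l _ eq3 a'a).
- exact: handle_class.
- by apply: eq_on_trans (handle_class v b'a a'b) => l _; apply: handleC_args.
- by case/negP: nab; rewrite -(eqv_l _ eq3 b'a).
Qed.

(** If the first change divides a component and the second one reunites it,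
    then both crossings lie on this component. *)
Lemma handle_merge_same v : E3 a b -> ~~ E1 a b -> E3 a' b' ->
  eq_on E3 (handle E3 a b v) (handle E3 a' b' v).
Proof.
move=> ab nab ab'; have [_ Es Et] := eq3.
have aa' : E3 a a'.
  move: (ab); rewrite {1}(surgery_merge W13 ab') /glue /= (negbTE nab) /=.
  case/andP=> /orP[/(sub13 ab') a'a|/(sub13 ab') b'a] _; rewrite Es //.
  exact: Et ab' b'a.
apply: handle_class => //; apply: (Et a') => //.
by apply: (Et a) => //; rewrite Es.
Qed.

(** With the numbers of components taken into account, the two ways around a
    square are of the same kind up to order, except for two changes keeping
    the number of components opposite a merging and a division. *)
Lemma paths_one : eq_on E3 (mulX E3 o (path1 (@unit_chain D)))
                           (mulX E3 o (path2 (@unit_chain D))).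
Proof.
apply: eq_on_trans (mulX_eq_on o eq3 path1_one) _.
apply: eq_on_trans _ (mulX_eq_on o eq3 (eq_on_sym path2_one)).
have C01 := surgery_connects S01; have C13 := surgery_connects S13.
have C02 := surgery_connects S02; have C23 := surgery_connects S23.
have count : (~~ E0 a b + ~~ E1 a' b' + (~~ E2 a' b' + ~~ E3 a b) =
    ~~ E0 a' b' + ~~ E2 a b + (~~ E1 a b + ~~ E3 a' b'))%N.
  have := surgery_count S01; have := surgery_count S13.
  have := surgery_count S02; have := surgery_count S23.
  do 8!move: (nat_of_bool (~~ _)) => ?; lia.
rewrite /factor.
(* At each side of the square, the two truth values tell whether the components
   merge, divide or stay; the counts discard the incompatible combinations. *)
case u1: (E0 a b) C01 count => C01; case x1: (E1 a b) C01 => // _;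
case u2: (E1 a' b') C13 => C13; case x2: (E3 a' b') C13 => // _;
case y1: (E0 a' b') C02 => C02; case z1: (E2 a' b') C02 => // _;
case y2: (E2 a b) C23 => C23; case z2: (E3 a b) C23 => // _;
  move=> // _ /=; try (by move=> l lE; rewrite ?mulX0).
(* stay, stay against divide, merge *)
- by move=> l lE; rewrite mulX0 (handle_single13 _ u2 x2 lE).
(* stay, stay against merge, divide: staying at one crossing does not bring the
   arcs of the other one onto the same component *)
- by move: u2; rewrite (surgery_single_eq W01) ?u1 ?x1 ?y1.
- by move=> l _; rewrite /mulX !handle0; case: (l o).
- by move=> l _; rewrite /mulX !handle0; case: (l o).
- by move=> l _; rewrite /mulX !handle0; case: (l o).
- by apply: mulX_eq_on => //; apply: handle_comm.
- by move=> l lE; rewrite mulX0 (handle_single23 _ y2 z2 lE).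
- by apply: mulX_eq_on => //; apply: handle_merge_same; rewrite ?x1.
- by move: y2; rewrite (surgery_single_eq W02) ?u1 ?y1 ?z1.
- by apply: mulX_eq_on => //; apply: handle_split_same; rewrite ?x1 ?u2 ?z2.
Qed.

Definition delta (m : label) : label -> rat := fun l => (l == m)%:R.

Lemma delta_mulX (E : rel D) d m : equivalence E -> labels E m -> m d ->
  eq_on E (delta m) (mulX E d (delta (unlabel E d m))).
Proof.
move=> eqE mE md l lE; have [Er Es Et] := eqE; rewrite /delta /mulX.
case ld: (l d); last by case: eqP => // lm; rewrite -lm ld in md.
congr _%:R; congr nat_of_bool; apply/eqP/eqP => [->//|/ffunP lm].
apply/ffunP=> y; have := lm y; rewrite !ffunE.
by case dy: (E d y); rewrite ?andbT // -(lE _ _ dy) -(mE _ _ dy) ld md.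
Qed.

(** Every monomial is a product of classes, so linearity reduces the
    comparison to the unit, by induction on the number of factors. *)
Lemma paths_marked m : labels E0 m ->
  eq_on E3 (mulX E3 o (path1 (delta m))) (mulX E3 o (path2 (delta m))).
Proof.
have eq0 := surgery_eq W01.
have [N] := ubnP #|[set x | m x]|; elim: N m => // N IH m mN mE.
have [/existsP[d md]|m0] := boolP [exists d, m d]; last first.
  have -> : delta m = @unit_chain D.
    rewrite /delta /unit_chain; suff -> : m = [ffun=> false] by [].
    apply/ffunP => x; rewrite ffunE; apply/negbTE; apply: contra m0 => mx.
    by apply/existsP; exists x.
  exact: paths_one.
have dm := delta_mulX eq0 mE md; set m' := unlabel E0 d m in dm.
have m'E : labels E0 m' by exact: unlabel_labels.
have IHm' : eq_on E3 (mulX E3 o (path1 (delta m'))) (mulX E3 o (path2 (delta m'))).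
  apply: IH => //; rewrite -ltnS; apply: leq_ltn_trans mN; apply: proper_card.
  apply/properP; split; first by apply/subsetP => x; rewrite !inE ffunE => /andP[].
  by exists d; rewrite !inE // ffunE; have [-> _ _] := eq0; rewrite andbF.
have P1 : eq_on E3 (path1 (delta m)) (mulX E3 d (path1 (delta m'))).
  apply: eq_on_trans _ (path1_mulX d (delta m')).
  by move=> l lE; apply: (step_eq_on W13) => //; apply: (step_eq_on W01).
have P2 : eq_on E3 (path2 (delta m)) (mulX E3 d (path2 (delta m'))).
  apply: eq_on_trans _ (path2_mulX d (delta m')).
  by move=> l lE; apply: (step_eq_on W23) => //; apply: (step_eq_on W02).
apply: eq_on_trans (mulX_eq_on o eq3 P1) _.
apply: eq_on_trans _ (eq_on_sym (mulX_eq_on o eq3 P2)).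
apply: eq_on_trans (mulXC _ _ _ eq3) _.
apply: eq_on_trans _ (mulXC _ _ _ eq3).
exact: mulX_eq_on.
Qed.

(** A chain of the complex is divisible by the class of the segment component. *)
Lemma surgeries_commute m : labels E0 m -> m o ->
  eq_on E3 (path1 (delta m)) (path2 (delta m)).
Proof.
move=> mE mo; have eq0 := surgery_eq W01.
have dm := delta_mulX eq0 mE mo; set m' := unlabel E0 o m in dm.
apply: eq_on_trans (step_eq_on W13 (step_eq_on W01 dm)) _.
apply: eq_on_trans _ (eq_on_sym (step_eq_on W23 (step_eq_on W02 dm))).
apply: eq_on_trans (path1_mulX _ _) _.
apply: eq_on_trans _ (eq_on_sym (path2_mulX _ _)).
by apply: paths_marked; apply: unlabel_labels.
Qed.

End CommutingSquare.

(** * The differential of a state *)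

Section Differential.
Variables (n m : nat) (K : pdcode n m).
Hypotheses (orK : oriented K) (spK : spherical K).
Local Notation D := (dart n m).
Local Notation label := {ffun D -> bool}.
Implicit Types (s : state n) (c : 'I_n) (l : label).

Lemma labels_strand s l :
  reflect (labels (same_component K s) l)
    [forall x, forall y, strand K s x y ==> (l x == l y)].
Proof.
apply: (iffP idP) => [/forallP lP x y|lP]; last first.
  apply/forallP => x; apply/forallP => y; apply/implyP => xy.
  by apply/eqP/lP; apply: connect1.
move=> xy; apply/eqP; apply: (@connect_rel_ind _ (strand K s)
  [rel x y | l x == l y]) xy => [z|z t u|z t zt] /=.
- exact: eqxx.
- by move=> /eqP-> /eqP->.
- by have /forallP/(_ t)/implyP := lP z; apply.
Qed.

Lemma labellingE s l : labelling K s l -> labels (same_component K s) l /\ l ldart.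
Proof. by case/andP=> -> /labels_strand. Qed.

Lemma same_component_eq s : equivalence (same_component K s).
Proof.
split; [exact: same_component_refl | exact: same_component_sym |].
exact: same_component_trans.
Qed.

(** Planarity enters the algebra here, through the clause on changes that keep
    the number of components. *)
Lemma crossing_surgery s c : ~~ s c ->
  curve_surgery (same_component K s) (same_component K (set1_at s c))
    (under_in c) (under_out c) ldart (ncomponents K s) (ncomponents K (set1_at s c)).
Proof.
move=> sc; have off c' : c' != c -> set1_at s c c' = s c' by exact: set1_at_off.
have off' c' : c' != c -> s c' = set1_at s c c' by move/off.
split.
- split; [exact: same_component_eq | exact: same_component_eq | |].
    exact: (same_component_switch orK off).
  exact: (same_component_switch orK off').
- by have := one_component_after orK sc; case: same_component => //= ->.
- exact: single_cycle_segment.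
case u: (same_component K s _ _); case x: (same_component K (set1_at s c) _ _) => /=.
- congr (_ + _)%N; apply: eq_n_comp => y z.
  exact: (same_component_single orK off u x).
- by rewrite addn0 addn1 (ncomponents_merge orK off' (negbT x) u).
- by rewrite addn0 addn1 (ncomponents_merge orK off (negbT u) x).
have := one_component_after orK sc; rewrite u x; by move/(_ isT).
Qed.

(** The surgery coefficient in terms of states and labellings instead of
    generators, so that it can be summed over labellings of a fixed state. *)
Definition label_coef c s s' l l' : rat :=
  let one := connect (strand K s) (under_in c) (under_out c) in
  let one' := connect (strand K s') (under_in c) (under_out c) in
  if [forall d, changed K s c d || (l d == l' d)] then
    if ~~ one && one' then
      mul_coef (l (under_in c)) (l (under_out c)) (l' (under_in c))
    else if one && ~~ one' then
      comul_coef (l (under_in c)) (l' (under_in c)) (l' (under_out c))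
    else 0
  else 0.

Lemma sum_labelling_delta s l (v : label -> rat) :
    labels (same_component K s) l -> (~~ l ldart -> v l = 0) ->
  \sum_(l0 | labelling K s l0) (l0 == l)%:R * v l0 = v l.
Proof.
move=> lE v0; have [lP|lP] := boolP (labelling K s l).
  rewrite (bigD1 l) //= eqxx mul1r big1 ?addr0 // => l0 /andP[_ /negbTE ->].
  by rewrite mul0r.
rewrite v0; last by apply: contra lP => lo; apply/andP; split=> //; apply/labels_strand.
rewrite big1 // => l0 l0P; case: eqP => [E|]; last by rewrite mul0r.
by rewrite -E l0P in lP.
Qed.

Definition agree_off (E : rel D) a b l l0 :=
  [forall x, (E a x || E b x) || (l x == l0 x)].

(** A labelling is determined by its values at the crossing and away from the
    changed components, which are the data on which surgery coefficients
    depend. *)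
Lemma labels_eqE (E : rel D) a b l l0 : equivalence E -> labels E l -> labels E l0 ->
  (l == l0) = [&& agree_off E a b l l0, l a == l0 a & l b == l0 b].
Proof.
move=> [Er _ _] lE l0E; apply/eqP/and3P => [->|[/forallP off /eqP la /eqP lb]].
  by split=> //; apply/forallP => x; rewrite eqxx orbT.
apply/ffunP => x; have := off x.
by case/orP=> [/orP[] xE|/eqP //]; rewrite -(lE _ _ xE) -(l0E _ _ xE).
Qed.

Lemma agree_off_unlabel (E F : rel D) a b d l l0 :
    (forall x, F d x -> E a x || E b x) ->
  agree_off E a b l (unlabel F d l0) = agree_off E a b l l0.
Proof.
move=> dE; apply: eq_forallb => x; rewrite ffunE.
case xE: (E a x || E b x) => //; suff -> : F d x = false by rewrite andbT.
by apply: contraFF xE => /dE.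
Qed.

(** The matrix of coefficients of the complex acts as the multiplication or
    comultiplication of the Frobenius algebra. *)
Lemma sum_label_coef s c l' (v : label -> rat) : ~~ s c ->
    let s' := set1_at s c in
    labels (same_component K s') l' ->
    (forall l, labels (same_component K s) l -> ~~ l ldart -> v l = 0) ->
  \sum_(l | labelling K s l) label_coef c s s' l l' * v l =
  step (same_component K s) (same_component K s') (under_in c) (under_out c) v l'.
Proof.
move=> sc s' l'E v0; have S := curve_surgeryW (crossing_surgery sc).
set a : D := under_in c; set b : D := under_out c.
pose E := same_component K s; pose E' := same_component K s'.
have coefE l : label_coef c s s' l l' = if agree_off E a b l l' then
    if ~~ E a b && E' a b then mul_coef (l a) (l b) (l' a)
    else if E a b && ~~ E' a b then comul_coef (l a) (l' a) (l' b) else 0 else 0.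
  by [].
under eq_bigr do rewrite coefE.
rewrite -/E -/E' in S l'E v0 *; rewrite /step.
have eqE := surgery_eq S; have eqE' := surgery_eq' S.
have [Er Es Et] := eqE; have [Er' Es' Et'] := eqE'.
case: ifP => [/andP[ab ab']|_].
  have l'sub : labels E l'.
    by move=> x y xy; apply: l'E; rewrite (surgery_merge S ab') /glue /= xy.
  have l'b : l' b = l' a by apply/esym/l'E.
  have uE d : labels E (unlabel E d l') by exact: unlabel_labels.
  have ba : E b a = false by rewrite Es; apply/negbTE.
  rewrite /merge; case l'a: (l' a) in l'b *.
    rewrite -(sum_labelling_delta (uE a) (v0 _ (uE a))).
    rewrite -(sum_labelling_delta (uE b) (v0 _ (uE b))) -big_split /=.
    apply: eq_bigr => l /labellingE[lE _]; rewrite -mulrDl; congr (_ * _).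
    rewrite !(labels_eqE a b eqE lE (uE _)) !agree_off_unlabel => [|x ->|x ->];
      rewrite ?orbT // !ffunE l'a l'b !Er ba (negbTE ab) /mul_coef.
    by case: agree_off; case: (l a); case: (l b).
  rewrite -(sum_labelling_delta l'sub (v0 _ l'sub)); apply: eq_bigr => l.
  case/labellingE => lE _; congr (_ * _).
  rewrite (labels_eqE a b eqE lE l'sub) l'a l'b /mul_coef.
  by case: agree_off; case: (l a); case: (l b).
case: ifP => [/andP[ab ab']|_]; last first.
  by rewrite big1 // => l _; rewrite if_same mul0r.
have E'E x y : E x y = E' x y || ((E' a x || E' b x) && (E' a y || E' b y)).
  exact: (surgery_split S ab).
have aK x : E a x = E' a x || E' b x.
  by rewrite E'E Er'; case: (E' a x); case: (E' b x).
have uE : labels E (unlabel E a l').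
  move=> x y xy; rewrite !ffunE -![E a _]Es [E x a]Es [E y a]Es.
  have -> : E a x = E a y by rewrite ![E a _]Es; apply: eqv_l.
  have [ya|ya] := boolP (E a y); rewrite ?andbF ?andbT //.
  apply: l'E; move: xy; rewrite E'E => /orP[//|/andP[_]].
  by rewrite -aK (negbTE ya).
rewrite /split; case: ifP => [/andP[l'a l'b]|l'ab].
  have l'sub : labels E l'.
    move=> x y; rewrite E'E => /orP[/l'E //|/andP[xK yK]].
    by case/orP: xK => /l'E <-; case/orP: yK => /l'E <-; rewrite ?l'a ?l'b.
  rewrite -(sum_labelling_delta l'sub (v0 _ l'sub)); apply: eq_bigr => l.
  case/labellingE => lE _; congr (_ * _).
  rewrite (labels_eqE a b eqE lE l'sub) l'a l'b /comul_coef -(lE _ _ ab).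
  by case: agree_off; case: (l a).
case: ifP => l'or; last first.
  rewrite big1 // => l /labellingE[lE _]; rewrite /comul_coef.
  by case: (l' a) (l' b) l'or => [] [] //= _; rewrite ?if_same ?mul0r.
rewrite -(sum_labelling_delta uE (v0 _ uE)); apply: eq_bigr => l.
case/labellingE => lE _; congr (_ * _).
rewrite (labels_eqE a b eqE lE uE) agree_off_unlabel => [|x ->//].
rewrite !ffunE Er ab !andbF -(lE _ _ ab) /comul_coef.
by case: agree_off; case: (l' a) (l' b) l'ab l'or => [] [] //= _ _; case: (l a).
Qed.

End Differential.

Section SquareZero.
Variables (n m : nat) (K : pdcode n m).
Hypotheses (orK : oriented K) (spK : spherical K).
Local Notation D := (dart n m).
Local Notation label := {ffun D -> bool}.
Implicit Types (s : state n) (c : 'I_n) (l : label).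

Lemma sum_generator (V : nmodType) (F : state n -> label -> V) :
  \sum_(g : generator K) F (gstate g) (glabel g) =
  \sum_s \sum_(l | labelling K s l) F s l.
Proof.
rewrite pair_big_dep /=.
by rewrite (big_sub [pred g : state n * label | labelling K g.1 g.2]
  (fun g => F g.1 g.2)).
Qed.

Definition state_coef s l s' l' : rat :=
  \sum_(c | ~~ s c && (s' == set1_at s c))
    wedge_sign s c * label_coef K c s s' l l'.

Lemma diff_coefE (g g' : generator K) :
  diff_coef g g' = state_coef (gstate g) (glabel g) (gstate g') (glabel g').
Proof. by []. Qed.

Lemma set1_atC s c c' : set1_at (set1_at s c) c' = set1_at (set1_at s c') c.
Proof. by apply/ffunP => x; rewrite !ffunE orbCA. Qed.

Lemma wedge_sign_set1 s c c' : ~~ s c ->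
  wedge_sign (set1_at s c) c' = (-1) ^+ (c < c')%N * wedge_sign s c'.
Proof.
move=> sc; rewrite /wedge_sign -exprD; congr (_ ^+ _).
have [cc'|cc'] := boolP (c < c')%N; last first.
  apply: eq_card => x; rewrite !inE ffunE; case: eqP => //= ->.
  by rewrite (negbTE cc') andbF.
have -> : [set x | set1_at s c x & (x < c')%N] = c |: [set x | s x & (x < c')%N].
  by apply/setP => x; rewrite !inE ffunE; case: eqP => //= ->; rewrite cc'.
by rewrite cardsU1 inE (negbTE sc).
Qed.

Lemma wedge_signC s c c' : ~~ s c -> ~~ s c' -> c != c' ->
  wedge_sign s c * wedge_sign (set1_at s c) c' =
  - (wedge_sign s c' * wedge_sign (set1_at s c') c).
Proof.
move=> sc sc' cc'; rewrite !wedge_sign_set1 //.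
have : (c != c' :> nat) by [].
rewrite neq_ltn => /orP[lt|lt]; rewrite lt ltnNge (ltnW lt) /= expr0 expr1; ring.
Qed.

(** Both sums are matrix coefficients of composites around a square of
    surgeries. *)
Lemma label_coef_square s c c' l l'' : ~~ s c -> ~~ s c' -> c != c' ->
    labelling K s l ->
    let s'' := set1_at (set1_at s c) c' in labelling K s'' l'' ->
  \sum_(l' | labelling K (set1_at s c) l')
    label_coef K c s (set1_at s c) l l' * label_coef K c' (set1_at s c) s'' l' l'' =
  \sum_(l' | labelling K (set1_at s c') l')
    label_coef K c' s (set1_at s c') l l' * label_coef K c (set1_at s c') s'' l' l''.
Proof.
move=> sc sc' cc' /labellingE[lE lo] s'' /labellingE[l''E _].
have path d d' : ~~ s d -> ~~ set1_at s d d' ->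
    set1_at (set1_at s d) d' = s'' ->
  \sum_(l' | labelling K (set1_at s d) l')
    label_coef K d s (set1_at s d) l l' * label_coef K d' (set1_at s d) s'' l' l'' =
  step (same_component K (set1_at s d)) (same_component K s'')
    (under_in d') (under_out d')
    (step (same_component K s) (same_component K (set1_at s d))
      (under_in d) (under_out d) (delta l)) l''.
  move=> sd sd' ss''; rewrite -ss''.
  have W := curve_surgeryW (crossing_surgery orK spK sd).
  have first l' : labels (same_component K (set1_at s d)) l' ->
      step (same_component K s) (same_component K (set1_at s d))
      (under_in d) (under_out d) (delta l) l' = label_coef K d s (set1_at s d) l l'.
    move=> l'E; rewrite -sum_label_coef // => [|l0 _ l0o]; last first.
      by rewrite /delta; case: eqP => // E; rewrite E lo in l0o.
    rewrite (bigD1 l) /=; last by rewrite /labelling lo; apply/labels_strand.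
    rewrite /delta eqxx mulr1 big1 ?addr0 // => l0 /andP[_ /negbTE ->].
    by rewrite mulr0.
  rewrite -sum_label_coef // ?ss'' //.
    apply: eq_bigr => l' /labellingE[l'E _]; rewrite first // mulrC //.
  move=> l' l'E l'o.
  have dl := delta_mulX (surgery_eq W) lE lo.
  rewrite (step_eq_on W dl l'E) (step_mulX W _ _ l'E).
  by rewrite /mulX (negbTE l'o).
have s'E d d' : ~~ s d' -> d != d' -> ~~ set1_at s d d'.
  by move=> sd' dd'; rewrite ffunE eq_sym (negbTE dd').
rewrite path ?s'E //.
rewrite [RHS]path ?s'E //; [|by rewrite eq_sym|exact: set1_atC].
have S01 := crossing_surgery orK spK sc.
have S13 := crossing_surgery orK spK (s'E _ _ sc' cc').
have S02 := crossing_surgery orK spK sc'.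
have c'c : c' != c by rewrite eq_sym.
have S23 := crossing_surgery orK spK (s'E _ _ sc c'c).
rewrite (set1_atC s c' c) in S23.
exact: (surgeries_commute S01 S13 S02 S23 lE lo).
Qed.

(** Composites through the two intermediate states cancel: the coefficients
    agree by [label_coef_square], and the signs are opposite because c and c'
    anticommute. *)
Lemma diff_coef_square (g g'' : generator K) :
  \sum_(g' : generator K) diff_coef g g' * diff_coef g' g'' = 0.
Proof.
under eq_bigr do rewrite !diff_coefE.
set s := gstate g; set l := glabel g; set s'' := gstate g''; set l'' := glabel g''.
rewrite (sum_generator (fun s' l' => state_coef s l s' l' * state_coef s' l' s'' l'')).
pose term c c' : rat :=
  if [&& ~~ s c, ~~ set1_at s c c' & s'' == set1_at (set1_at s c) c']
  then wedge_sign s c * wedge_sign (set1_at s c) c' *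
    \sum_(l' | labelling K (set1_at s c) l')
      label_coef K c s (set1_at s c) l l' * label_coef K c' (set1_at s c) s'' l' l''
  else 0.
have -> : \sum_s' \sum_(l' | labelling K s' l')
    state_coef s l s' l' * state_coef s' l' s'' l'' = \sum_c \sum_c' term c c'.
  transitivity (\sum_s' \sum_(c | ~~ s c && (s' == set1_at s c)) \sum_c' term c c').
    apply: eq_bigr => s' _; rewrite /state_coef.
    under eq_bigr do rewrite mulr_suml.
    rewrite exchange_big /=; apply: eq_bigr => c /andP[sc /eqP ->].
    under eq_bigr do rewrite mulr_sumr.
    rewrite exchange_big /= big_mkcond /=; apply: eq_bigr => c' _.
    rewrite /term sc /=; case: ifP => // _; rewrite mulr_sumr.
    by apply: eq_bigr => l' _; rewrite mulrACA.
  under eq_bigr do rewrite big_mkcond /=.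
  rewrite exchange_big /=; apply: eq_bigr => c _.
  rewrite (bigD1 (set1_at s c)) //= eqxx andbT.
  rewrite [X in _ + X]big1 ?addr0 => [|s' /negbTE ->].
    case: ifP => // sc; rewrite big1 // => c' _.
    by rewrite /term sc.
  by rewrite andbF.
have termN c c' : term c c' = - term c' c.
  rewrite /term; have [->|cc'] := eqVneq c c'.
    by rewrite set1_at_in !andbF oppr0.
  have setE d d' : d != d' -> set1_at s d d' = s d'.
    by move=> dd'; rewrite ffunE eq_sym (negbTE dd').
  rewrite setE // (setE c' c); last by rewrite eq_sym.
  rewrite andbCA set1_atC.
  case: (boolP [&& ~~ s c', ~~ s c & s'' == set1_at (set1_at s c') c]);
    last by rewrite oppr0.
  case/and3P=> sc' sc /eqP s''E.
  rewrite wedge_signC // mulNr; congr (- (_ * _)).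
  have lP : labelling K s l by exact: (valP g).
  have l''P : labelling K s'' l'' by exact: (valP g'').
  rewrite s''E (set1_atC s c' c) in l''P *.
  exact: label_coef_square.
have : \sum_c \sum_c' term c c' = - \sum_c \sum_c' term c c'.
  rewrite [in RHS]exchange_big /= -sumrN; apply: eq_bigr => c _.
  by rewrite -sumrN; apply: eq_bigr => c' _.
by move/eqP; rewrite -addr_eq0 -mulr2n mulrn_eq0 => /eqP.
Qed.

End SquareZero.

(** * Gradings *)

Section Grading.
Variables (n m : nat) (K : pdcode n m) (alpha : seq (dart n m)).
Hypotheses (orK : oriented K) (spK : spherical K) (shortK : shortcut K alpha).
Implicit Types (s : state n) (c : 'I_n).

Lemma weight_set1 s c : ~~ s c -> weight (set1_at s c) = (weight s).+1.
Proof.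
move=> sc; rewrite /weight.
have -> : [set x | set1_at s c x] = c |: [set x | s x].
  by apply/setP => x; rewrite !inE ffunE.
by rewrite cardsU1 inE sc.
Qed.

Lemma surgery_coef_neq0 c (g g' : generator K) : surgery_coef c g g' != 0 ->
  let s := gstate g in let s' := gstate g' in
  [/\ forall x, ~~ changed K s c x -> glabel g' x = glabel g x,
      same_component K s (under_in c) (under_out c) !=
      same_component K s' (under_in c) (under_out c) &
      if same_component K s (under_in c) (under_out c)
      then (glabel g' (under_in c) + glabel g' (under_out c) =
        (glabel g (under_in c)).+1)%N
      else (glabel g (under_in c) + glabel g (under_out c) =
        glabel g' (under_in c))%N].
Proof.
rewrite /surgery_coef; case: ifP; rewrite ?eqxx // => /forallP off.
rewrite -!/(same_component _ _ _ _).
have nz (b : bool) : b%:R != 0 :> rat -> b by case: b; rewrite ?eqxx.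
move=> coef; split.
- by move=> x xK; have := off x; rewrite (negbTE xK) => /eqP.
- by move: coef; do 2!case: same_component; rewrite ?eqxx.
by move: coef; do 2!case: same_component; rewrite ?eqxx //= => /nz/eqP.
Qed.

(** Whichever of the two states has the arcs of [c] on distinct components may
    serve as the starting point of [segment_dot_smoothing]. *)
Lemma surgery_mu c (g g' : generator K) :
    gstate g' = set1_at (gstate g) c -> surgery_coef c g g' != 0 ->
  mu K alpha (gstate g') = mu K alpha (gstate g).
Proof.
move=> s'E /surgery_coef_neq0 [_ ab _]; congr (_ - _).
have off c' : c' != c -> gstate g' c' = gstate g c' by rewrite s'E; apply: set1_at_off.
have [u|u] := boolP (same_component K (gstate g) (under_in c) (under_out c)).
  apply/esym/(segment_dot_smoothing orK spK (c := c)) => // [c' /off //|].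
  by move: ab; rewrite u.
exact: (segment_dot_smoothing orK spK off u).
Qed.

(** Multiplication and comultiplication lower the degree by one, which makes
    up for the weight of the new state in the q-grading. *)
Lemma surgery_gdeg c (g g' : generator K) :
    gstate g' = set1_at (gstate g) c -> surgery_coef c g g' != 0 ->
  gdeg g' = gdeg g - 1.
Proof.
move=> s'E /surgery_coef_neq0 [lab ab balance].
have off c' : c' != c -> gstate g' c' = gstate g c' by rewrite s'E; apply: set1_at_off.
have off' c' : c' != c -> gstate g c' = gstate g' c' by move/off.
have degE (h : generator K) x y : same_component K (gstate h) x y ->
    deg (glabel h x) = deg (glabel h y).
  by have [lE _] := labellingE (valP h : labelling K (gstate h) (glabel h)) => /lE ->.
have [u|u] := boolP (same_component K (gstate g) (under_in c) (under_out c)).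
  have u' : ~~ same_component K (gstate g') (under_in c) (under_out c).
    by move: ab; rewrite u.
  have deg_off x : ~~ changed K (gstate g') c x ->
      deg (glabel g x) = deg (glabel g' x).
    rewrite (changed_merged orK off' u) => xK; rewrite lab // changedE.
    rewrite (negbTE xK) /=; apply: contra xK; exact: same_component_trans u.
  have := sum_components_merge orK off' u' u (degE g') (degE g) deg_off.
  rewrite -!/(gdeg _); move: balance; rewrite u.
  move: (glabel g' _) (glabel g' _) (glabel g _) => p q r.
  by case: p q r => [] [] [] //= _; rewrite /deg; lia.
have u' : same_component K (gstate g') (under_in c) (under_out c).
  by move: ab; rewrite (negbTE u); case: same_component.
have deg_off x : ~~ changed K (gstate g) c x ->
    deg (glabel g' x) = deg (glabel g x) by move=> /lab ->.
have := sum_components_merge orK off u u' (degE g) (degE g') deg_off.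
rewrite -!/(gdeg _); move: balance; rewrite (negbTE u).
move: (glabel g _) (glabel g _) (glabel g' _) => p q r.
by case: p q r => [] [] [] //= _; rewrite /deg; lia.
Qed.

Lemma diff_coef_grading (g g' : generator K) : diff_coef g g' != 0 ->
  grading alpha g' = (igrading g + 1, qgrading g, ugrading alpha g).
Proof.
move=> nz; have [c /andP[/andP[sc /eqP s'E] cnz]] : exists c,
    (~~ gstate g c && (gstate g' == set1_at (gstate g) c)) &&
    (surgery_coef c g g' != 0).
  apply/existsP; apply: contraNT nz => /existsPn none.
  rewrite /diff_coef big1 // => c cP; have := none c; rewrite cP negbK => /eqP ->.
  by rewrite mulr0.
have iE : igrading g' = igrading g + 1.
  by rewrite /igrading s'E weight_set1 // -addn1 PoszD addrAC.
have qE : qgrading g' = qgrading g.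
  by rewrite /qgrading iE (surgery_gdeg s'E cnz); ring.
by rewrite /grading /ugrading (surgery_mu s'E cnz) iE qE.
Qed.

End Grading.

(** * The Euler characteristic of the winding complex *)

Section EulerCharacteristic.
Variables (n m : nat) (K : pdcode n m) (alpha : seq (dart n m)).
Hypotheses (orK : oriented K) (spK : spherical K) (shortK : shortcut K alpha).
Local Notation G := (generator K).
Local Notation chains := (chains K).
Implicit Types (g : G) (i j k : int).

Lemma gen_chainE g h : gen_chain g h = (h == g)%:R.
Proof. by rewrite ffunE. Qed.

Lemma diffE (v : chains) h : diff K v h = \sum_g diff_coef g h * v g.
Proof. by rewrite /diff lfunE /= ffunE. Qed.

Lemma diff_gen g g' : diff K (gen_chain g) g' = diff_coef g g'.
Proof.
rewrite diffE (bigD1 g) //= ffunE eqxx mulr1 big1 ?addr0 // => h hg.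
by rewrite ffunE (negbTE hg) mulr0.
Qed.

Lemma diff_genE g : diff K (gen_chain g) = \sum_g' diff_coef g g' *: gen_chain g'.
Proof.
apply/ffunP => h; rewrite [LHS]diff_gen sum_ffunE (bigD1 h) //.
rewrite ffunE (_ : gen_chain h h = 1); last by rewrite gen_chainE eqxx.
rewrite /GRing.scale /= mulr1 big1 ?addr0 // => g' g'h.
by rewrite ffunE gen_chainE eq_sym (negbTE g'h) /GRing.scale /= mulr0.
Qed.

Lemma diff_square v : diff K (diff K v) = 0.
Proof.
apply/ffunP => h; rewrite diffE ffunE.
under eq_bigr do rewrite diffE mulr_sumr.
rewrite exchange_big /= big1 // => g _.
under eq_bigr do rewrite mulrA [diff_coef _ _ * _]mulrC.
by rewrite -mulr_suml diff_coef_square // mul0r.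
Qed.

Lemma free_gen_chain (gs : seq G) : uniq gs -> free [seq gen_chain g | g <- gs].
Proof.
elim: gs => [|g gs IH] /=; first by rewrite nil_free.
case/andP=> ggs /IH gsF; rewrite free_cons gsF andbT.
apply/negP => /(@coord_span _ _ _ (in_tuple _)) /ffunP /(_ g).
rewrite sum_ffunE ffunE eqxx.
rewrite big1 => [/eqP|p _]; first by rewrite oner_eq0.
have pgs : (p < size gs)%N by rewrite -(size_map (@gen_chain _ _ K)).
rewrite ffunE (nth_map g) // ffunE; case: eqP => [E|_]; last first.
  by rewrite /GRing.scale /= mulr0.
by case/negP: ggs; rewrite E mem_nth.
Qed.

Lemma dim_graded_chains i j k : \dim (graded_chains K alpha i j k) =
  #|[set g : G | grading alpha g == (i, j, k)]|.
Proof.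
have /eqP -> := free_gen_chain (filter_uniq
  (fun g : G => grading alpha g == (i, j, k)) (enum_uniq G)).
rewrite size_map -(card_uniqP (filter_uniq _ (enum_uniq G))).
by apply: eq_card => g; rewrite mem_filter mem_enum andbT inE.
Qed.

Lemma mem_graded_chains g i j k : grading alpha g = (i, j, k) ->
  gen_chain g \in graded_chains K alpha i j k.
Proof.
move=> gE; apply: memv_span; apply: map_f.
by rewrite mem_filter gE eqxx mem_enum.
Qed.

Lemma diff_graded_chains i j k :
  (diff K @: graded_chains K alpha i j k <= graded_chains K alpha (i + 1) j k)%VS.
Proof.
rewrite limg_span; apply/span_subvP => _ /mapP[_ /mapP[g + ->] ->].
rewrite mem_filter => /andP[/eqP gE _]; rewrite diff_genE; apply: memv_suml => g' _.
have [->|nz] := eqVneq (diff_coef g g') 0; first by rewrite scale0r mem0v.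
apply/memvZ/mem_graded_chains; rewrite (diff_coef_grading orK spK shortK nz).
by case: gE => -> -> ->.
Qed.

Definition rank_diff (x : int * int * int) : nat :=
  \dim (diff K @: graded_chains K alpha x.1.1 x.1.2 x.2).

Lemma cycles_rank i j k : (\dim (cycles K alpha i j k) + rank_diff (i, j, k) =
  \dim (graded_chains K alpha i j k))%N.
Proof. exact: limg_ker_dim. Qed.

Lemma betti_rank i j k :
  (betti K alpha i j k + rank_diff ((i - 1)%R, j, k) = \dim (cycles K alpha i j k))%N.
Proof.
have bz : (boundaries K alpha i j k <= cycles K alpha i j k)%VS.
  rewrite subv_cap; apply/andP; split.
    by have := diff_graded_chains (i - 1) j k; rewrite subrK.
  by apply/subvP => _ /memv_imgP[v _ ->]; rewrite memv_ker diff_square.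
rewrite addnC -(dimv_cap_compl _ (boundaries K alpha i j k)).
by move/capv_idPr: bz => ->.
Qed.

Lemma rank_diff_eq0 i j k :
    (forall g, grading alpha g <> (i, j, k)) \/
    (forall g, grading alpha g <> (i + 1, j, k)) ->
  rank_diff (i, j, k) = 0%N.
Proof.
have C0 i' : (forall g, grading alpha g <> (i', j, k)) ->
    graded_chains K alpha i' j k = 0%VS.
  move=> none; apply/eqP; rewrite -dimv_eq0 dim_graded_chains cards_eq0.
  by apply/eqP/setP => g; rewrite !inE; apply/eqP/none.
rewrite /rank_diff; case=> /C0 E; first by rewrite E limg0 dimv0.
by apply/eqP; rewrite dimv_eq0 -subv0 -E diff_graded_chains.
Qed.

Variables (R : comUnitRingType) (q u : R).
Definition monomial (x : int * int * int) : R :=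
  (-1) ^ x.1.1 * q ^ x.1.2 * u ^ x.2.

(** In each grading the dimension of the chains is the sum of the Betti
    number, of the outgoing rank and of the incoming rank; the incoming rank
    is the outgoing rank of the previous degree, where the sign is opposite. *)
Lemma euler_characteristic :
  winding_poincare K alpha (-1) q u = \sum_(g : G) monomial (grading alpha g).
Proof.
rewrite /winding_poincare; set gs := undup _.
have gsP x : reflect (exists g, grading alpha g = x) (x \in gs).
  rewrite mem_undup; apply: (iffP mapP) => [[g _ ->]|[g <-]]; exists g => //.
  by rewrite mem_enum.
pose up (x : int * int * int) : int * int * int := (x.1.1 + 1, x.1.2, x.2).
pose down (x : int * int * int) : int * int * int := (x.1.1 - 1, x.1.2, x.2).
have upK : cancel up down by case=> [[i j] k]; rewrite /up /down /= addrK.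
have downK : cancel down up by case=> [[i j] k]; rewrite /up /down /= subrK.
have rank0 x : ~~ ((x \in gs) && (up x \in gs)) -> rank_diff x = 0%N.
  rewrite negb_and => none; case: x none => [[i j] k] none.
  by apply: rank_diff_eq0; case/orP: none => none; [left | right] => g gE;
    case/negP: none; apply/gsP; exists g.
have monomial_up x : monomial (up x) = - monomial x.
  by rewrite /monomial /= exprzDr ?unitrN1 // expr1z mulrN1 !mulNr.
(* The ranks are nonzero only where both the source and the target of the
   differential occur, so the shift by one degree permutes the relevant terms. *)
have shift : \sum_(x <- gs) monomial x * (rank_diff (down x))%:R =
    - \sum_(x <- gs) monomial x * (rank_diff x)%:R.
  rewrite (bigID (fun x => down x \in gs)) /= addrC big1_seq ?add0r; last first.
    by move=> x /andP[dx _]; rewrite rank0 ?mulr0 // negb_and dx.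
  rewrite [in RHS](bigID (fun x => up x \in gs)) /=.
  rewrite [X in - (_ + X)]big1_seq; last first.
    by move=> x /andP[ux _]; rewrite rank0 ?mulr0 // negb_and ux orbT.
  rewrite addr0 -sumrN -big_filter -[RHS]big_filter.
  have permG : perm_eq [seq x <- gs | down x \in gs]
      (map up [seq x <- gs | up x \in gs]).
    apply: uniq_perm; first by rewrite filter_uniq ?undup_uniq.
      by rewrite (map_inj_uniq (can_inj upK)) filter_uniq ?undup_uniq.
    move=> x; rewrite -[x in RHS]downK (mem_map (can_inj upK)) !mem_filter downK.
    by rewrite andbC.
  rewrite (perm_big _ permG) big_map; apply: eq_bigr => x _.
  by rewrite monomial_up upK mulNr.
transitivity (\sum_(x <- gs) monomial x * #|[set g : G | grading alpha g == x]|%:R).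
  have -> : \sum_(x <- gs) monomial x * #|[set g : G | grading alpha g == x]|%:R =
      \sum_(x <- gs) monomial x * (betti K alpha x.1.1 x.1.2 x.2)%:R +
      (\sum_(x <- gs) monomial x * (rank_diff (down x))%:R +
       \sum_(x <- gs) monomial x * (rank_diff x)%:R).
    rewrite -!big_split; apply: eq_bigr => x _ /=; rewrite -!mulrDr -!natrD.
    congr (_ * _%:R); case: x => [[i j] k].
    by rewrite addnA betti_rank cycles_rank dim_graded_chains.
  by rewrite shift addNr addr0.
have countE x : monomial x * #|[set g : G | grading alpha g == x]|%:R =
    \sum_(g : G) if grading alpha g == x then monomial x else 0.
  rewrite -big_mkcond -sum1dep_card natr_sum mulr_sumr /=.
  by apply: eq_bigr => g _; rewrite mulr1.
under eq_bigr do rewrite countE.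
rewrite exchange_big /=; apply: eq_bigr => g _.
have gG : grading alpha g \in gs by apply/gsP; exists g.
rewrite (bigD1_seq _ gG) ?undup_uniq // eqxx big1 => [|x xg]; first exact: addr0.
by rewrite eq_sym (negbTE xg).
Qed.

End EulerCharacteristic.

(** * The state sum *)

Section StateSum.
Variables (n m : nat) (K : pdcode n m) (alpha : seq (dart n m)).
Hypothesis orK : oriented K.
Variables (R : comUnitRingType) (q u : R).
Hypothesis q_unit : q \is a GRing.unit.
Local Notation D := (dart n m).
Local Notation label := {ffun D -> bool}.

(** A labelling is a free choice of 1 or X on each component except the
    segment, which carries X.  Distributing the product over the components
    gives a factor q + q^-1 for each closed one. *)
Lemma sum_labellings (s : state n) :
  \sum_(l : label | labelling K s l)
    q ^ (\sum_(d | roots (strand K s) d) deg (l d)) =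
  q^-1 * (q + q^-1) ^+ (ncomponents K s).-1.
Proof.
have sym : connect_sym (strand K s) by exact: same_component_sym.
have exp_sum (l : label) : q ^ (\sum_(d | roots (strand K s) d) deg (l d)) =
    \prod_(d | roots (strand K s) d) q ^ deg (l d).
  by apply: (big_morph (fun i => q ^ i)) => [i j|]; rewrite ?exprzDr ?expr0z.
under eq_bigr do rewrite exp_sum.
pose o := root (strand K s) ldart.
have oR : roots (strand K s) o by exact: roots_root.
pose allowed d : pred bool := fun b => (d == o) ==> b.
transitivity (\prod_(d | roots (strand K s) d) \sum_(b | allowed d b) q ^ deg b).
  rewrite (big_distr_big_dep false) /=.
  pose restrict (l : label) : label := [ffun d => roots (strand K s) d && l d].
  pose extend (f : label) : label := [ffun d => f (root (strand K s) d)].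
  rewrite [RHS](reindex_onto restrict extend) /=; last first.
    move=> f /pfamilyP[/supportP sf _]; apply/ffunP => d; rewrite !ffunE.
    case dR: (roots _ d) => /=; first by rewrite (eqP dR).
    by rewrite sf // -topredE /= dR.
  apply: eq_big => [l|l /andP[lo _]].
    have rootE d : root (strand K s) (root (strand K s) d) ==
        root (strand K s) d by rewrite root_root.
    apply/idP/andP => [/labellingE[lE lo]|[/pfamilyP[_ famP] /eqP/ffunP lE]].
      have lroot d : l (root (strand K s) d) = l d.
        by apply/esym/lE; apply: connect_root.
      split; last by apply/eqP/ffunP => d; rewrite !ffunE /roots /= rootE lroot.
      apply/pfamilyP; split=> [|d dR].
        by apply/supportP => d; rewrite ffunE -topredE /= => /negbTE ->.
      rewrite ffunE -topredE /allowed /=; apply/implyP => /eqP ->.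
      by rewrite /o lroot lo andbT; exact: oR.
    have lroot d : l d = l (root (strand K s) d).
      by rewrite -{1}lE !ffunE /roots /= rootE.
    apply/andP; split.
      have := famP o oR; rewrite ffunE -topredE /allowed /= eqxx /=.
      by case/andP=> _; rewrite -lroot.
    apply/labels_strand => x y xy; rewrite lroot [RHS]lroot; congr (l _).
    exact/fingraph.rootP.
  by apply: eq_bigr => d dR; rewrite ffunE dR.
rewrite (bigD1 o) //=; congr (_ * _).
  rewrite big_mkcond /= big_bool /allowed eqxx /=.
  by rewrite addr0.
rewrite (eq_bigr (fun=> q + q^-1)) => [|d /andP[dR do_]]; last first.
  rewrite big_mkcond /= big_bool /allowed (negbTE do_) /= addrC.
  done.
rewrite prodr_const; congr (_ ^+ _).
have -> : ncomponents K s = #|roots (strand K s)|.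
  by apply: eq_card => d; rewrite !inE andbT.
rewrite (cardD1 o) -topredE /= oR.
by apply: eq_card => d; rewrite !inE andbC.
Qed.

End StateSum.

Theorem theorem3p12 (n m : nat) (K : pdcode n m) (alpha : seq (dart n m))
    (R : comUnitRingType) (q u : R) :
  multiknotoid_diagram K -> shortcut K alpha ->
  q \is a GRing.unit -> u \is a GRing.unit ->
  winding_poincare K alpha (-1) q u = turaev K alpha q u.
Proof.
case=> orK spK short qU _; rewrite euler_characteristic //.
pose F (s : state n) (l : {ffun dart n m -> bool}) : R :=
  let i := (weight s)%:Z - (nneg K)%:Z in
  (-1) ^ i * q ^ (\sum_(d | roots (strand K s) d) deg (l d) + i +
    (npos K)%:Z - (nneg K)%:Z + 1) * u ^ mu K alpha s.
rewrite (sum_generator K F : \sum_(g : generator K) monomial q u (grading alpha g) = _).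
rewrite /turaev mulr_sumr; apply: eq_bigr => s _.
have FE l : F s l = q ^ (\sum_(d | roots (strand K s) d) deg (l d)) *
    ((-1) ^+ nneg K * q ^ ((npos K)%:Z - (2 * nneg K)%N%:Z) * u ^ mu K alpha s *
     (- q) ^+ weight s * q).
  have sgn : (-1) ^ ((weight s)%:Z - (nneg K)%:Z) =
      (-1) ^+ weight s * (-1) ^+ nneg K :> R.
    by rewrite exprzDr ?unitrN1 // -exprz_inv invrN1.
  rewrite /F sgn; set D := \sum_(d | _) _.
  have -> : D + ((weight s)%:Z - (nneg K)%:Z) + (npos K)%:Z - (nneg K)%:Z + 1 =
      D + ((npos K)%:Z - (2 * nneg K)%N%:Z) + (weight s)%:Z + 1 by lia.
  move: ((npos K)%:Z - _) => e.
  rewrite 3!(exprzDr qU) expr1z [(- q) ^+ _]exprNn.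
  have -> : q ^ (weight s)%:Z = q ^+ weight s by [].
  move: (q ^ D) (q ^ e) (u ^ _) ((-1) ^+ nneg K) ((-1) ^+ weight s) (q ^+ _).
  by move=> *; ring.
under eq_bigr do rewrite FE.
rewrite -mulr_suml sum_labellings //.
have qV : q^-1 * q = 1 by exact: mulVr.
move: (_ ^+ (ncomponents K s).-1) (q ^ _) (u ^ _) ((-1) ^+ _) ((- q) ^+ _) => S x y z t.
transitivity (q^-1 * q * (z * x * (y * t * S))); first by ring.
by rewrite qV mul1r.
Qed.
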